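(* Let $\vec B\in C^3(\mathbb{R}^2,\mathbb{R}^2)$ satisfy the standing sign conditions listed in the context. Let $k\in C^3(\mathbb{R}^2)$ and $K\in C^1(\mathbb{R}^2)$ be functions with $k(x,y)\ne0$ for all $(x,y)\in\mathbb{R}^2$. Let $\alpha\in(0,d/2)$ and let $D_\alpha$, $F$, $g$, $\Gamma_{ij}^m$, $S^{(1)}$, $S^{(2)}$, $H$, $\Psi$, $\Theta$ be as in the context. Let $u\in C^2(D_\alpha)$ be such that $\Delta_\parallel u:=\mathrm{div}\big(k\,(\vec b\otimes\vec b)\nabla u\big)=0$ in $D_\alpha$, and let $P,Q\in C^2((0,\alpha))$ be the functions such that $$u\circ F(x_0,t)=P(x_0)+Q(x_0)\int_0^t\Psi_{x_0}(s)\,ds\qquad\text{for all }(x_0,t)\in(0,\alpha)\times\mathbb{R}.$$ Then $L_Ku:=\mathrm{div}(K\nabla u)$ is given, for all $(x_0,t)\in(0,\alpha)\times\mathbb{R}$, by $$(L_Ku)\circ F(x_0,t)=\sum_{i,j}g^{ij}(K\circ F)\,\partial_{ij}(u\circ F)+\sum_m\Big(-(K\circ F)\sum_{p,q}g^{pq}\Gamma_{pq}^m+\sum_p g^{pm}\partial_p(K\circ F)\Big)\partial_m(u\circ F),$$ where all indices range over $\{t,x_0\}$, where the derivatives of $u\circ F$ are \begin{align*} \partial_t(u\circ F)&=Q(x_0)\Psi_{x_0}(t),\\ \partial_{tt}(u\circ F)&=-H(\Phi_t(x_0,L/2))\,Q(x_0)\Psi_{x_0}(t),\\ \partial_{x_0}(u\circ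 F)&=P'(x_0)+Q'(x_0)\int_0^t\Psi_{x_0}(s)\,ds+Q(x_0)\int_0^t\Theta_{x_0}(s)\Psi_{x_0}(s)\,ds,\\ \partial_{tx_0}(u\circ F)&=Q'(x_0)\Psi_{x_0}(t)+Q(x_0)\Theta_{x_0}(t)\Psi_{x_0}(t),\\ \partial_{x_0x_0}(u\circ F)&=P''(x_0)+Q''(x_0)\int_0^t\Psi_{x_0}(s)\,ds+2Q'(x_0)\int_0^t\Theta_{x_0}(s)\Psi_{x_0}(s)\,ds+Q(x_0)\int_0^t\Theta_{x_0}(s)^2\Psi_{x_0}(s)\,ds\\ &\quad-Q(x_0)\int_0^t\Big(\int_0^sD^2H(\Phi_\tau(x_0,L/2))\big[S^{(1)}_\tau(x_0),S^{(1)}_\tau(x_0)\big]d\tau\Big)\Psi_{x_0}(s)\,ds\\ &\quad-Q(x_0)\int_0^t\Big(\int_0^sDH(\Phi_\tau(x_0,L/2))\big[S^{(2)}_\tau(x_0)\big]d\tau\Big)\Psi_{x_0}(s)\,ds, \end{align*} and where $$\sum_{p,q}g^{pq}\Gamma_{pq}^m=\sum_{i,j,l}g^{ij}g^{ml}\partial_ig_{lj}-\frac12\sum_{i,j,l}g^{ij}g^{ml}\partial_lg_{ij}$$ with \begin{align*} \partial_tg_{tt}&=\partial_{x_0}g_{tt}=0,\\ \partial_tg_{tx_0}&=\langle D\vec b(\Phi_t(x_0,L/2))[\vec b(\Phi_t(x_0,L/2))],S^{(1)}_t(x_0)\rangle,\\ \partial_{x_0}g_{tx_0}&=\langle\vec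 b(\Phi_t(x_0,L/2)),S^{(2)}_t(x_0)\rangle+\langle D\vec b(\Phi_t(x_0,L/2))[S^{(1)}_t(x_0)],S^{(1)}_t(x_0)\rangle,\\ \partial_tg_{x_0x_0}&=2\langle D\vec b(\Phi_t(x_0,L/2))[S^{(1)}_t(x_0)],S^{(1)}_t(x_0)\rangle,\\ \partial_{x_0}g_{x_0x_0}&=2\langle S^{(2)}_t(x_0),S^{(1)}_t(x_0)\rangle. \end{align*}
   Context: Standing conditions on $\vec B=(B_x,B_y)$: there are constants $\varepsilon,d,L>0$ such that, with $S:=(d/2,L/2)$, for $(x,y)\in(-\varepsilon,d+\varepsilon)\times\mathbb{R}$ one has $\vec B(x,y)=\vec 0$ if and only if $(x,y)=S$, and moreover: $B_x>0$ in $(0,d)\times(-\infty,L/2)$ and $B_x<0$ in $(0,d)\times(L/2,+\infty)$; $B_x<0$ in $(-\varepsilon,0)\times(-\infty,L/2)$ and $B_x>0$ in $(-\varepsilon,0)\times(L/2,+\infty)$; $B_y>0$ in $(-\varepsilon,d/2)\times\mathbb{R}$ and $B_y<0$ in $(d/2,d+\varepsilon)\times\mathbb{R}$; $B_x(0,y)=B_x(d,y)=0$ for all $y\in\mathbb{R}$; $B_y(x,L)>0$ and $B_y(x,0)>0$ for $0\le x<d/2$. The normalized field is $\vec b:=\vec B/\|\vec B\|$ on $((-\varepsilon,d+\varepsilon)\times\mathbb{R})\setminus\{S\}$ (Euclidean norm); $D\vec b$ is its Jacobian. The flow $t\mapsto\Phi_t(p)$ is the solution of $\frac{d}{dt}\Phi_t(p)=\vec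 b(\Phi_t(p))$, $\Phi_0(p)=p$; trajectories starting at $(x_0,L/2)$ with $-\varepsilon/2<x_0<d/2$ are defined for all $t\in\mathbb{R}$. Set $S^{(1)}_t(x_0):=\partial_{x_0}\Phi_t(x_0,L/2)$ and $S^{(2)}_t(x_0):=\partial^2_{x_0x_0}\Phi_t(x_0,L/2)$. For $\alpha\in(0,d/2)$ write $(x_\alpha(t),y_\alpha(t)):=\Phi_t(\alpha,L/2)$, $t\in\mathbb{R}$; $y_\alpha$ is a $C^1$-diffeomorphism from $\mathbb{R}$ onto an open interval $I\supset[0,L]$. Define $D_\alpha:=\{(x,y)\in(0,d/2)\times I:\ 0<x<x_\alpha(y_\alpha^{-1}(y))\}$ and $F:(0,\alpha)\times\mathbb{R}\to D_\alpha$, $F(x_0,t):=\Phi_t(x_0,L/2)$, which is a $C^1$-diffeomorphism. The pullback metric $g=(g_{ij})_{i,j\in\{t,x_0\}}$ on $(0,\alpha)\times\mathbb{R}$ is $g_{tt}=\langle\partial_tF,\partial_tF\rangle=1$, $g_{tx_0}=g_{x_0t}=\langle\partial_tF,\partial_{x_0}F\rangle=\langle\vec b(\Phi_t(x_0,L/2)),S^{(1)}_t(x_0)\rangle$, $g_{x_0x_0}=\langle\partial_{x_0}F,\partial_{x_0}F\rangle=\|S^{(1)}_t(x_0)\|^2$; $(g^{ij})$ is the inverse matrix. Christoffel symbols: $\Gamma_{ij}^m:=\frac12\sum_lg^{ml}(\partial_ig_{lj}+\partial_jg_{il}-\partial_lg_{ij})$. $H(x,y):=\mathrm{Tr}(D\vec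 b(x,y))+\langle\nabla k,\vec b\rangle(x,y)/k(x,y)$; $\Psi_{x_0}(s):=\exp\big(-\int_0^sH(\Phi_\tau(x_0,L/2))\,d\tau\big)$; $\Theta_{x_0}(t):=-\int_0^tDH(\Phi_s(x_0,L/2))[S^{(1)}_s(x_0)]\,ds$. *)

(* Defs.v *)
(* Stdlib reals with Coquelicot. *)
From Stdlib Require Import Reals.
From Coquelicot Require Import Coquelicot.
Open Scope R_scope.

(** * Calculus on the plane *)

Definition vec : Type := (R * R)%type.

Definition inner (v w : vec) : R := fst v * fst w + snd v * snd w.
Definition norm2 (v : vec) : R := sqrt (inner v v).
Definition vscale (a : R) (v : vec) : vec := (a * fst v, a * snd v).

(* [ex_diff_n f n x y] asks, at the point [(x, y)], for all the iterated partial
   derivatives of order at most [n] to exist and be continuous; required at every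
   point of an open set [D], this is exactly membership in C^n(D). *)
Definition Cn_plane (n : nat) (D : vec -> Prop) (f : vec -> R) : Prop :=
  forall x y, D (x, y) -> ex_diff_n (fun x' y' => f (x', y')) n x y.

Definition Cn_plane_vec (n : nat) (D : vec -> Prop) (v : vec -> vec) : Prop :=
  Cn_plane n D (fun p => fst (v p)) /\ Cn_plane n D (fun p => snd (v p)).

Definition Cn_line (n : nat) (D : R -> Prop) (f : R -> R) : Prop :=
  forall x m, D x -> (m <= n)%nat -> ex_derive_n f m x /\ continuous (Derive_n f m) x.

Definition plane (p : vec) : Prop := True.

Definition dx (f : vec -> R) (p : vec) : R := Derive (fun x => f (x, snd p)) (fst p).
Definition dy (f : vec -> R) (p : vec) : R := Derive (fun y => f (fst p, y)) (snd p).
Definition grad (f : vec -> R) (p : vec) : vec := (dx f p, dy f p).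
Definition div (v : vec -> vec) (p : vec) : R :=
  dx (fun q => fst (v q)) p + dy (fun q => snd (v q)) p.

(* [Dscal f p] and [D2scal f p] are the first and second differentials of a scalar
   function, [Dvec v p] the Jacobian of a vector field, as (bi)linear maps. *)
Definition Dscal (f : vec -> R) (p w : vec) : R := inner (grad f p) w.
Definition D2scal (f : vec -> R) (p v w : vec) : R :=
  Dscal (fun q => Dscal f q w) p v.
Definition Dvec (v : vec -> vec) (p w : vec) : vec :=
  (Dscal (fun q => fst (v q)) p w, Dscal (fun q => snd (v q)) p w).
Definition trace (A : vec -> vec) : R := fst (A (1, 0)) + snd (A (0, 1)).

(* [(a (x) b) w = <b, w> a] *)
Definition tensor (a b w : vec) : vec := vscale (inner b w) a.

(** * The field and its flow *)

Definition strip (eps d : R) (p : vec) : Prop := - eps < fst p < d + eps.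

Record standing (eps d L : R) (B : vec -> vec) : Prop := Standing {
  eps_pos : 0 < eps;
  d_pos : 0 < d;
  L_pos : 0 < L;
  B_zero : forall p, strip eps d p -> (B p = (0, 0) <-> p = (d / 2, L / 2));
  Bx_in_low : forall x y, 0 < x < d -> y < L / 2 -> 0 < fst (B (x, y));
  Bx_in_high : forall x y, 0 < x < d -> L / 2 < y -> fst (B (x, y)) < 0;
  Bx_out_low : forall x y, - eps < x < 0 -> y < L / 2 -> fst (B (x, y)) < 0;
  Bx_out_high : forall x y, - eps < x < 0 -> L / 2 < y -> 0 < fst (B (x, y));
  By_left : forall x y, - eps < x < d / 2 -> 0 < snd (B (x, y));
  By_right : forall x y, d / 2 < x < d + eps -> snd (B (x, y)) < 0;
  Bx_walls : forall y, fst (B (0, y)) = 0 /\ fst (B (d, y)) = 0;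
  By_ends : forall x, 0 <= x < d / 2 -> 0 < snd (B (x, L)) /\ 0 < snd (B (x, 0))
}.

(* Only meaningful where [B] does not vanish. *)
Definition normalize (B : vec -> vec) (p : vec) : vec := vscale (/ norm2 (B p)) (B p).

Definition field_domain (eps d L : R) (p : vec) : Prop :=
  strip eps d p /\ p <> (d / 2, L / 2).

Definition trajectory (U : vec -> Prop) (v : vec -> vec) (p : vec) (c : R -> vec) : Prop :=
  c 0 = p /\
  forall t, U (c t) /\
    is_derive (fun s => fst (c s)) t (fst (v (c t))) /\
    is_derive (fun s => snd (c s)) t (snd (v (c t))).

(* [v] being locally Lipschitz on the open set [field_domain eps d L], this determines
   [Phi t (x0, L / 2)] for all [- eps / 2 < x0 < d / 2] and all [t]; the values of
   [Phi] at other starting points, where the flow need not be complete, are left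
   unconstrained and are never used. *)
Definition is_flow (eps d L : R) (v : vec -> vec) (Phi : R -> vec -> vec) : Prop :=
  forall x0, - eps / 2 < x0 < d / 2 ->
    trajectory (field_domain eps d L) v (x0, L / 2) (fun t => Phi t (x0, L / 2)).

Definition flow_coord (L : R) (Phi : R -> vec -> vec) (x0 t : R) : vec :=
  Phi t (x0, L / 2).

(* With [(x_alpha, y_alpha) := F alpha], the interval [I] is the range of the injective
   function [y_alpha], and the witness [t] below is [y_alpha^-1 (snd p)]. *)
Definition D_alpha (d alpha : R) (F : R -> R -> vec) (p : vec) : Prop :=
  0 < fst p < d / 2 /\
  exists t, snd (F alpha t) = snd p /\ 0 < fst p < fst (F alpha t).

Definition S1 (F : R -> R -> vec) (x0 t : R) : vec :=
  (Derive (fun x => fst (F x t)) x0, Derive (fun x => snd (F x t)) x0).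
Definition S2 (F : R -> R -> vec) (x0 t : R) : vec :=
  (Derive_n (fun x => fst (F x t)) 2 x0, Derive_n (fun x => snd (F x t)) 2 x0).

Definition Hfun (k : vec -> R) (b : vec -> vec) (p : vec) : R :=
  trace (Dvec b p) + inner (grad k p) (b p) / k p.

Definition Psi (H : vec -> R) (F : R -> R -> vec) (x0 s : R) : R :=
  exp (- RInt (fun tau => H (F x0 tau)) 0 s).

Definition Theta (H : vec -> R) (F : R -> R -> vec) (x0 t : R) : R :=
  - RInt (fun s => Dscal H (F x0 s) (S1 F x0 s)) 0 t.

(** * The pullback metric *)

(* Functions of the coordinates are written [f x0 t]; [It] and [Ix] are the indices
   of the coordinates [t] and [x0]. *)
Inductive idx : Type := It | Ix.

Definition isum (f : idx -> R) : R := f It + f Ix.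

Definition pd (i : idx) (f : R -> R -> R) (x0 t : R) : R :=
  match i with
  | It => Derive (fun s => f x0 s) t
  | Ix => Derive (fun x => f x t) x0
  end.

Definition is_pd (i : idx) (f : R -> R -> R) (x0 t l : R) : Prop :=
  match i with
  | It => is_derive (fun s => f x0 s) t l
  | Ix => is_derive (fun x => f x t) x0 l
  end.

Definition pd_vec (i : idx) (F : R -> R -> vec) (x0 t : R) : vec :=
  (pd i (fun x s => fst (F x s)) x0 t, pd i (fun x s => snd (F x s)) x0 t).

Definition metric (F : R -> R -> vec) (i j : idx) (x0 t : R) : R :=
  inner (pd_vec i F x0 t) (pd_vec j F x0 t).

Definition det2 (a : idx -> idx -> R) : R := a It It * a Ix Ix - a It Ix * a Ix It.

Definition inv2 (a : idx -> idx -> R) (i j : idx) : R :=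
  match i, j with
  | It, It => a Ix Ix / det2 a
  | It, Ix => - a It Ix / det2 a
  | Ix, It => - a Ix It / det2 a
  | Ix, Ix => a It It / det2 a
  end.

Lemma inv2_spec (a : idx -> idx -> R) : det2 a <> 0 ->
  forall i j, isum (fun l => inv2 a i l * a l j) =
              match i, j with It, It | Ix, Ix => 1 | _, _ => 0 end.
Proof.
intros Ha [|] [|]; unfold isum, inv2; unfold det2 in *; field; exact Ha.
Qed.

Definition inv_metric (g : idx -> idx -> R -> R -> R) (i j : idx) (x0 t : R) : R :=
  inv2 (fun p q => g p q x0 t) i j.

Definition Christoffel (g : idx -> idx -> R -> R -> R) (i j m : idx) (x0 t : R) : R :=
  / 2 * isum (fun l => inv_metric g m l x0 t *
    (pd i (g l j) x0 t + pd j (g i l) x0 t - pd l (g i j) x0 t)).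

(* Main.v *)
(** The abscissa of a trajectory starting at [(x0, L / 2)] with [0 < x0 < d / 2] decreases in both
    time directions, by the sign conditions, and cannot vanish, since the line [x = 0] is
    invariant. So these trajectories stay in the convex region where [B_y > 0]; being parametrized
    by arc length, they reach every height, and they never cross, which places [F] in [D_alpha].

    Since [|b| = 1], the variational equation reduces to quadratures: one solution is [b] along
    the trajectory, and the determinant of two solutions is given by Liouville's formula. A Gronwall
    estimate identifies the resulting explicit function of the flow with [S1]. As it is as
    regular as the flow itself, [F] is of class C^1, then C^2, and the same determinant shows
    that [F] is an immersion.

    The derivatives of [u o F] then follow from the formula in terms of [P] and [Q] by
    differentiation under the integral sign, and the formula for [div (K grad u)] from the chain
    rule and an algebraic identity. *)

(* The obstacle is regularity: the statement needs two derivatives of the flow in the starting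
   point. The quadrature formula takes the place of an existence theorem for the linearized system.
   [F] enters it only through compositions and primitives in time, which lose no regularity, while
   the field is differentiated once; so a C^3 field allows the passage from C^n to C^(n+1) for n <=
   2. The same count makes [H] of class C^2, as D^2H requires.

   The estimates take place in closed boxes [0, m] x [l - T, l + T] with m < d / 2. Such a box
   contains, up to time T, all trajectories with starting abscissa at most m, and it lies in the
   open strip - eps < x < d / 2 where the normalized field is C^3; the margin eps puts the wall x =
   0 in the interior. The constants depend on the box and on T only, hence are uniform over
   neighbouring starting points.

   For the operator, the partials of [F] form a moving frame (b, S1). The metric, its derivatives
   and the second derivatives of [F] are expressed through this frame and its derivatives, so the
   formula becomes a rational identity at a single point, with the Gram determinant as
   denominator. *)
Require Import Defs.
From Stdlib Require Import Reals Lra Psatz Nsatz Classical IndefiniteDescription.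
From Coquelicot Require Import Coquelicot.
Open Scope R_scope.

(** * Functions of class C^n on an open subset of the plane *)

Lemma continuity_2d_pt_vec (f : vec -> R) (x y : R) :
  continuity_2d_pt (fun x' y' => f (x', y')) x y <->
  continuous f (x, y).
Proof.
rewrite continuity_2d_pt_filterlim. unfold continuous.
split; apply filterlim_ext; now intros [].
Qed.

Lemma open_locally_2d (D : vec -> Prop) (x y : R) :
  open D -> D (x, y) -> locally_2d (fun u v => D (u, v)) x y.
Proof.
intros HD Hp. apply locally_2d_locally.
generalize (HD _ Hp). apply filter_imp. now intros [].
Qed.

Section ClassCn.

Variable D : vec -> Prop.
Hypothesis D_open : open D.

Lemma Cn_plane_le n m f : (m <= n)%nat -> Cn_plane n D f -> Cn_plane m D f.
Proof. intros H Hf x y Hp. exact (ex_diff_n_m n m H _ _ _ (Hf x y Hp)). Qed.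

Lemma Cn_plane_continuous n f p : Cn_plane n D f -> D p -> continuous f p.
Proof.
destruct p as [x y]. intros Hf Hp. apply continuity_2d_pt_vec.
generalize (Hf x y Hp). destruct n; intros H; exact (proj1 H).
Qed.

Lemma Cn_plane_dx n f : Cn_plane (S n) D f -> Cn_plane n D (dx f).
Proof. intros Hf x y Hp. exact (proj1 (proj2 (proj2 (proj2 (Hf x y Hp))))). Qed.

Lemma Cn_plane_dy n f : Cn_plane (S n) D f -> Cn_plane n D (dy f).
Proof. intros Hf x y Hp. exact (proj2 (proj2 (proj2 (proj2 (Hf x y Hp))))). Qed.

Lemma Cn_plane_is_dx n f x y : Cn_plane (S n) D f -> D (x, y) ->
  is_derive (fun z => f (z, y)) x (dx f (x, y)).
Proof.
intros Hf Hp. apply Derive_correct. exact (proj1 (proj2 (Hf x y Hp))).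
Qed.

Lemma Cn_plane_is_dy n f x y : Cn_plane (S n) D f -> D (x, y) ->
  is_derive (fun z => f (x, z)) y (dy f (x, y)).
Proof.
intros Hf Hp. apply Derive_correct. exact (proj1 (proj2 (proj2 (Hf x y Hp)))).
Qed.

Lemma Cn_plane_ext n f g :
  (forall p, D p -> f p = g p) -> Cn_plane n D f -> Cn_plane n D g.
Proof.
intros Hfg Hf x y Hp. refine (ex_diff_n_ext_loc _ _ n x y _ (Hf x y Hp)).
destruct (open_locally_2d D x y D_open Hp) as [e He].
exists e; intros u v Hu Hv. now apply Hfg, He.
Qed.

Lemma Cn_plane_0_intro f : (forall p, D p -> continuous f p) -> Cn_plane 0 D f.
Proof.
intros Hf x y Hp. split; [|exact I]. now apply continuity_2d_pt_vec, Hf.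
Qed.

(** The rule behind the closure properties below. Explicit partials [fx] and [fy], instead of [dx f]
    and [dy f], let an induction on [n] apply its hypothesis to the usual differentiation formulas;
    both agree on the open set [D]. *)
Lemma Cn_plane_S_intro n f fx fy :
  (forall p, D p -> continuous f p) ->
  (forall x y, D (x, y) -> is_derive (fun z => f (z, y)) x (fx (x, y))) ->
  (forall x y, D (x, y) -> is_derive (fun z => f (x, z)) y (fy (x, y))) ->
  Cn_plane n D fx -> Cn_plane n D fy -> Cn_plane (S n) D f.
Proof.
intros Hc Hx Hy Hfx Hfy x y Hp. split; [now apply continuity_2d_pt_vec, Hc|].
split; [eexists; now apply Hx|]. split; [eexists; now apply Hy|]. split.
- refine (Cn_plane_ext n _ (dx f) _ Hfx x y Hp).
  intros [u v] Huv. symmetry. apply is_derive_unique. now apply Hx.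
- refine (Cn_plane_ext n _ (dy f) _ Hfy x y Hp).
  intros [u v] Huv. symmetry. apply is_derive_unique. now apply Hy.
Qed.

Lemma Cn_plane_const n c : Cn_plane n D (fun _ => c).
Proof.
revert c; induction n as [|n IH]; intros c.
- apply Cn_plane_0_intro. intros p _. apply continuous_const.
- apply (Cn_plane_S_intro n _ (fun _ => 0) (fun _ => 0)); auto.
  + intros p _. apply continuous_const.
  + intros x y _. exact (is_derive_const (V := R_NormedModule) _ _).
  + intros x y _. exact (is_derive_const (V := R_NormedModule) _ _).
Qed.

Lemma Cn_plane_fst n : Cn_plane n D (fun p => fst p).
Proof.
destruct n.
- apply Cn_plane_0_intro. intros p _. apply continuous_fst.
- apply (Cn_plane_S_intro n _ (fun _ => 1) (fun _ => 0)).
  + intros p _. apply continuous_fst.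
  + intros x y _. exact (is_derive_id (K := R_AbsRing) _).
  + intros x y _. exact (is_derive_const (V := R_NormedModule) _ _).
  + apply Cn_plane_const.
  + apply Cn_plane_const.
Qed.

Lemma Cn_plane_plus n f g :
  Cn_plane n D f -> Cn_plane n D g -> Cn_plane n D (fun p => f p + g p).
Proof.
revert f g; induction n as [|n IH]; intros f g Hf Hg.
- apply Cn_plane_0_intro. intros p Hp.
  apply (continuous_plus (V := R_NormedModule)); eapply Cn_plane_continuous; eauto.
- apply (Cn_plane_S_intro n _ (fun p => dx f p + dx g p) (fun p => dy f p + dy g p)).
  + intros p Hp. apply (continuous_plus (V := R_NormedModule)); eapply Cn_plane_continuous; eauto.
  + intros x y Hp. apply (is_derive_plus (V := R_NormedModule)); eapply Cn_plane_is_dx; eauto.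
  + intros x y Hp. apply (is_derive_plus (V := R_NormedModule)); eapply Cn_plane_is_dy; eauto.
  + apply IH; now apply Cn_plane_dx.
  + apply IH; now apply Cn_plane_dy.
Qed.

Lemma Cn_plane_mult n f g :
  Cn_plane n D f -> Cn_plane n D g -> Cn_plane n D (fun p => f p * g p).
Proof.
revert f g; induction n as [|n IH]; intros f g Hf Hg.
- apply Cn_plane_0_intro. intros p Hp.
  apply (continuous_mult (K := R_AbsRing)); eapply Cn_plane_continuous; eauto.
- assert (Hf' := Cn_plane_le (S n) n f (Nat.le_succ_diag_r n) Hf).
  assert (Hg' := Cn_plane_le (S n) n g (Nat.le_succ_diag_r n) Hg).
  apply (Cn_plane_S_intro n _ (fun p => dx f p * g p + f p * dx g p)
           (fun p => dy f p * g p + f p * dy g p)).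
  + intros p Hp. apply (continuous_mult (K := R_AbsRing)); eapply Cn_plane_continuous; eauto.
  + intros x y Hp.
    apply (is_derive_mult (fun z => f (z, y)) (fun z => g (z, y)));
      [eapply Cn_plane_is_dx; eauto .. | exact Rmult_comm].
  + intros x y Hp.
    apply (is_derive_mult (fun z => f (x, z)) (fun z => g (x, z)));
      [eapply Cn_plane_is_dy; eauto .. | exact Rmult_comm].
  + apply Cn_plane_plus; apply IH; auto; now apply Cn_plane_dx.
  + apply Cn_plane_plus; apply IH; auto; now apply Cn_plane_dy.
Qed.

Lemma Cn_plane_opp n f : Cn_plane n D f -> Cn_plane n D (fun p => - f p).
Proof.
intros Hf. apply (Cn_plane_ext n (fun p => (-1) * f p)).
- intros p _. ring.
- apply Cn_plane_mult; [apply Cn_plane_const | exact Hf].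
Qed.

Lemma Cn_plane_inv n f : (forall p, D p -> f p <> 0) ->
  Cn_plane n D f -> Cn_plane n D (fun p => / f p).
Proof.
intros H0. revert f H0; induction n as [|n IH]; intros f H0 Hf.
- intros x y Hp. split; [|exact I].
  apply (continuity_2d_pt_inv (fun u v => f (u, v))); [apply Hf|apply H0]; exact Hp.
- assert (Hf' := Cn_plane_le (S n) n f (Nat.le_succ_diag_r n) Hf).
  (* With [/ f] twice instead of a squared denominator, the derivative is covered by the induction
     hypothesis and by products. *)
  apply (Cn_plane_S_intro n _ (fun p => - (dx f p * (/ f p * / f p)))
           (fun p => - (dy f p * (/ f p * / f p)))).
  + intros [x y] Hp. apply continuity_2d_pt_vec.
    apply (continuity_2d_pt_inv (fun u v => f (u, v))); [apply Hf|apply H0]; exact Hp.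
  + intros x y Hp.
    replace (- (dx f (x, y) * (/ f (x, y) * / f (x, y))))
      with (- dx f (x, y) / f (x, y) ^ 2) by (field; now apply H0).
    apply (is_derive_inv (fun z => f (z, y))); [eapply Cn_plane_is_dx; eauto|now apply H0].
  + intros x y Hp.
    replace (- (dy f (x, y) * (/ f (x, y) * / f (x, y))))
      with (- dy f (x, y) / f (x, y) ^ 2) by (field; now apply H0).
    apply (is_derive_inv (fun z => f (x, z))); [eapply Cn_plane_is_dy; eauto|now apply H0].
  + apply Cn_plane_opp, Cn_plane_mult; [now apply Cn_plane_dx|apply Cn_plane_mult; auto].
  + apply Cn_plane_opp, Cn_plane_mult; [now apply Cn_plane_dy|apply Cn_plane_mult; auto].
Qed.

Lemma Cn_plane_sqrt n f : (forall p, D p -> 0 < f p) ->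
  Cn_plane n D f -> Cn_plane n D (fun p => sqrt (f p)).
Proof.
intros H0. revert f H0; induction n as [|n IH]; intros f H0 Hf.
- apply Cn_plane_0_intro. intros p Hp.
  apply continuous_comp; [eapply Cn_plane_continuous; eauto|apply continuous_sqrt].
- assert (Hf' := Cn_plane_le (S n) n f (Nat.le_succ_diag_r n) Hf).
  assert (Hi : Cn_plane n D (fun p => / (2 * sqrt (f p)))).
  { apply Cn_plane_inv.
    - intros p Hp. generalize (sqrt_lt_R0 _ (H0 p Hp)). lra.
    - apply Cn_plane_mult; [apply Cn_plane_const|auto]. }
  apply (Cn_plane_S_intro n _ (fun p => dx f p * / (2 * sqrt (f p)))
           (fun p => dy f p * / (2 * sqrt (f p)))).
  + intros p Hp.
    apply continuous_comp; [eapply Cn_plane_continuous; eauto|apply continuous_sqrt].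
  + intros x y Hp.
    apply (is_derive_sqrt (fun z => f (z, y))); [eapply Cn_plane_is_dx; eauto|now apply H0].
  + intros x y Hp.
    apply (is_derive_sqrt (fun z => f (x, z))); [eapply Cn_plane_is_dy; eauto|now apply H0].
  + apply Cn_plane_mult; [now apply Cn_plane_dx|exact Hi].
  + apply Cn_plane_mult; [now apply Cn_plane_dy|exact Hi].
Qed.

Lemma Cn_plane_exp n f : Cn_plane n D f -> Cn_plane n D (fun p => exp (f p)).
Proof.
revert f; induction n as [|n IH]; intros f Hf.
- apply Cn_plane_0_intro. intros p Hp.
  apply continuous_comp; [eapply Cn_plane_continuous; eauto|apply continuous_exp].
- assert (Hf' := Cn_plane_le (S n) n f (Nat.le_succ_diag_r n) Hf).
  apply (Cn_plane_S_intro n _ (fun p => dx f p * exp (f p)) (fun p => dy f p * exp (f p))).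
  + intros p Hp.
    apply continuous_comp; [eapply Cn_plane_continuous; eauto|apply continuous_exp].
  + intros x y Hp.
    apply (is_derive_comp exp (fun z => f (z, y)));
      [apply is_derive_exp|eapply Cn_plane_is_dx; eauto].
  + intros x y Hp.
    apply (is_derive_comp exp (fun z => f (x, z)));
      [apply is_derive_exp|eapply Cn_plane_is_dy; eauto].
  + apply Cn_plane_mult; [now apply Cn_plane_dx|auto].
  + apply Cn_plane_mult; [now apply Cn_plane_dy|auto].
Qed.

(** Partial derivatives alone give no chain rule. The Frechet differential is obtained from [dx f]
    existing near the point and being continuous there, together with [dy f] existing at the
    point. *)
Lemma Cn_plane_chain f (g h : R -> R) (t lg lh : R) :
  Cn_plane 1 D f -> D (g t, h t) -> is_derive g t lg -> is_derive h t lh ->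
  is_derive (fun s => f (g s, h s)) t (dx f (g t, h t) * lg + dy f (g t, h t) * lh).
Proof.
intros Hf Hp Hg Hh. apply is_derive_Reals.
apply (derivable_pt_lim_comp_2d (fun u v => f (u, v)));
  [|now apply is_derive_Reals..].
apply filterdiff_differentiable_pt_lim.
apply (is_derive_filterdiff (fun u v => f (u, v)) (g t) (h t)
         (fun u v => dx f (u, v)) (dy f (g t, h t))).
- generalize (D_open _ Hp). apply filter_imp. intros [u v] Huv.
  eapply Cn_plane_is_dx; eauto.
- eapply Cn_plane_is_dy; eauto.
- apply (proj1 (continuity_2d_pt_filterlim (fun u v => dx f (u, v)) _ _)).
  apply (continuity_2d_pt_vec (dx f)).
  eapply Cn_plane_continuous; [eapply Cn_plane_dx|]; eauto.
Qed.

End ClassCn.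

Lemma Cn_plane_comp n (D E : vec -> Prop) (f g h : vec -> R) :
  open D -> open E -> (forall p, E p -> D (g p, h p)) ->
  Cn_plane n D f -> Cn_plane n E g -> Cn_plane n E h ->
  Cn_plane n E (fun p => f (g p, h p)).
Proof.
intros HD HE HED.
assert (Hc : forall m f', Cn_plane m D f' -> Cn_plane m E g -> Cn_plane m E h ->
          forall p, E p -> continuous (fun p => f' (g p, h p)) p).
{ intros m f' Hf Hg Hh p Hp.
  apply (continuous_comp_2 g h (fun u v => f' (u, v)));
    [eapply Cn_plane_continuous; eauto..|].
  apply (continuous_ext f'); [now intros []|].
  eapply Cn_plane_continuous; eauto. }
revert f; induction n as [|n IH]; intros f Hf Hg Hh.
- apply Cn_plane_0_intro. now apply (Hc 0%nat).
- assert (Hg' := Cn_plane_le E (S n) n g (Nat.le_succ_diag_r n) Hg).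
  assert (Hh' := Cn_plane_le E (S n) n h (Nat.le_succ_diag_r n) Hh).
  assert (Hf1 := Cn_plane_le D (S n) 1 f (le_n_S 0 n (Nat.le_0_l n)) Hf).
  apply (Cn_plane_S_intro E HE n _
           (fun p => dx f (g p, h p) * dx g p + dy f (g p, h p) * dx h p)
           (fun p => dx f (g p, h p) * dy g p + dy f (g p, h p) * dy h p)).
  + now apply (Hc (S n)).
  + intros x y Hp.
    apply (Cn_plane_chain D HD f (fun z => g (z, y)) (fun z => h (z, y))); auto;
      eapply Cn_plane_is_dx; eauto.
  + intros x y Hp.
    apply (Cn_plane_chain D HD f (fun z => g (x, z)) (fun z => h (x, z))); auto;
      eapply Cn_plane_is_dy; eauto.
  + apply Cn_plane_plus; auto; apply Cn_plane_mult; auto.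
    * apply IH; auto; now apply Cn_plane_dx.
    * now apply Cn_plane_dx.
    * apply IH; auto; now apply Cn_plane_dy.
    * now apply Cn_plane_dx.
  + apply Cn_plane_plus; auto; apply Cn_plane_mult; auto.
    * apply IH; auto; now apply Cn_plane_dx.
    * now apply Cn_plane_dy.
    * apply IH; auto; now apply Cn_plane_dy.
    * now apply Cn_plane_dy.
Qed.

Lemma Cn_plane_comp_vec n (D E : vec -> Prop) (f : vec -> R) (A : vec -> vec) :
  open D -> open E -> (forall p, E p -> D (A p)) -> Cn_plane n D f ->
  Cn_plane n E (fun p => fst (A p)) -> Cn_plane n E (fun p => snd (A p)) ->
  Cn_plane n E (fun p => f (A p)).
Proof.
intros HD HE HED Hf H1 H2.
apply (Cn_plane_ext E HE n (fun p => f (fst (A p), snd (A p)))).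
- intros p _. now rewrite <- surjective_pairing.
- apply (Cn_plane_comp n D E); auto.
  intros p Hp. rewrite <- surjective_pairing. now apply HED.
Qed.

(** * Compactness and parameter integrals *)

(** Around each point a radius e is chosen with |f| <= A on the e-square and e * A <= 1, where A =
    |f(x, y)| + 1. Compactness bounds from below the radii of squares covering the rectangle; the
    inverse of this lower bound is the constant. *)
Lemma rectangle_bounded (f : vec -> R) (a b c d : R) :
  (forall x y, a <= x <= b -> c <= y <= d -> continuous f (x, y)) ->
  exists M, 0 < M /\ forall x y, a <= x <= b -> c <= y <= d -> Rabs (f (x, y)) <= M.
Proof.
intros Hf.
assert (Hd : forall x y, exists e : posreal, a <= x <= b -> c <= y <= d ->
  e * (Rabs (f (x, y)) + 1) <= 1 /\
  forall u v, Rabs (u - x) < e -> Rabs (v - y) < e -> Rabs (f (u, v)) <= Rabs (f (x, y)) + 1).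
{ intros x y. set (A := Rabs (f (x, y)) + 1).
  assert (HA : 0 < A) by (unfold A; generalize (Rabs_pos (f (x, y))); lra).
  destruct (Rle_dec a x) as [H1|H1]; [|exists (mkposreal 1 Rlt_0_1); lra].
  destruct (Rle_dec x b) as [H2|H2]; [|exists (mkposreal 1 Rlt_0_1); lra].
  destruct (Rle_dec c y) as [H3|H3]; [|exists (mkposreal 1 Rlt_0_1); lra].
  destruct (Rle_dec y d) as [H4|H4]; [|exists (mkposreal 1 Rlt_0_1); lra].
  assert (Hc := proj2 (continuity_2d_pt_vec f x y) (Hf x y (conj H1 H2) (conj H3 H4))).
  destruct (Hc (mkposreal 1 Rlt_0_1)) as [e He]; simpl in He.
  assert (Hm : 0 < Rmin e (/ A)).
  { apply Rmin_pos; [apply cond_pos|now apply Rinv_0_lt_compat]. }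
  exists (mkposreal _ Hm); intros _ _; simpl. split.
  - apply Rle_trans with (/ A * A); [apply Rmult_le_compat_r; [lra|apply Rmin_r]|].
    right; field; lra.
  - intros u v Hu Hv.
    assert (H := He u v (Rlt_le_trans _ _ _ Hu (Rmin_l _ _))
                   (Rlt_le_trans _ _ _ Hv (Rmin_l _ _))).
    generalize (Rabs_triang_inv (f (u, v)) (f (x, y))). unfold A. simpl in H. lra. }
(* The covering lemma takes the radius as a function of the point, hence the choice. Its conclusion
   is a double negation, hence the proof by contradiction below. *)
assert (Hd' : forall x y, {e : posreal | a <= x <= b -> c <= y <= d ->
  e * (Rabs (f (x, y)) + 1) <= 1 /\
  forall u v, Rabs (u - x) < e -> Rabs (v - y) < e -> Rabs (f (u, v)) <= Rabs (f (x, y)) + 1}).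
{ intros x y. apply constructive_indefinite_description, Hd. }
destruct (compactness_value_2d a b c d (fun x y => proj1_sig (Hd' x y))) as [e He].
exists (/ e). split; [apply Rinv_0_lt_compat, cond_pos|].
intros x y Hx Hy. apply NNPP; intros Hn. apply (He x y Hx Hy).
intros (u & v & Hu & Hv & H1 & H2 & H3). apply Hn.
destruct (Hd' u v) as [e' He']; simpl in *. destruct (He' Hu Hv) as [H4 H5].
apply Rle_trans with (Rabs (f (u, v)) + 1); [now apply H5|].
assert (0 < e) by apply cond_pos.
apply Rmult_le_reg_l with e; [easy|]. rewrite Rinv_r by lra.
apply Rle_trans with (2 := H4). apply Rmult_le_compat_r; [|easy].
generalize (Rabs_pos (f (u, v))). lra.
Qed.

(** * Monotonicity and a two-sided Gronwall estimate *)

Lemma incr_le (f df : R -> R) (a b : R) : a <= b ->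
  (forall t, a <= t <= b -> is_derive f t (df t)) ->
  (forall t, a < t < b -> 0 <= df t) -> f a <= f b.
Proof.
intros [Hab|<-] Hd Hp; [|lra].
destruct (MVT_cor2 f df a b Hab) as (c & Hc & Hc').
- intros t Ht. now apply is_derive_Reals, Hd.
- specialize (Hp c Hc'). nra.
Qed.

Lemma incr_lt (f df : R -> R) (a b : R) : a < b ->
  (forall t, a <= t <= b -> is_derive f t (df t)) ->
  (forall t, a < t < b -> 0 < df t) -> f a < f b.
Proof.
intros Hab Hd Hp.
destruct (MVT_cor2 f df a b Hab) as (c & Hc & Hc').
- intros t Ht. now apply is_derive_Reals, Hd.
- specialize (Hp c Hc'). nra.
Qed.

(** The shift by [c / A] absorbs the constant term: |dphi| <= A (phi + c / A). Hence (phi + c / A)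
    exp(- A t) does not increase for t >= 0, and (phi + c / A) exp(A t) does not decrease for t <=
    0. *)
Lemma gronwall (phi dphi : R -> R) (A c T : R) : 0 < A ->
  (forall t, Rabs t <= T -> is_derive phi t (dphi t)) ->
  (forall t, Rabs t <= T -> Rabs (dphi t) <= A * phi t + c) ->
  forall t, Rabs t <= T -> phi t + c / A <= (phi 0 + c / A) * exp (A * Rabs t).
Proof.
intros HA Hd Hb t Ht.
assert (Hs : forall s, A * (phi s + c / A) = A * phi s + c) by (intros; field; lra).
destruct (Rle_dec 0 t) as [H0|H0].
- rewrite Rabs_pos_eq in * by easy.
  assert (H : (phi 0 + c / A) * - exp (- A * 0) <= (phi t + c / A) * - exp (- A * t)).
  2:{ rewrite Rmult_0_r, exp_0 in H.
      apply Rmult_le_reg_r with (exp (- A * t)); [apply exp_pos|].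
      rewrite Rmult_assoc, <- exp_plus.
      replace (A * t + - A * t) with 0 by ring. rewrite exp_0. lra. }
  apply (incr_le (fun s => (phi s + c / A) * - exp (- A * s))
    (fun s => (A * (phi s + c / A) - dphi s) * exp (- A * s))); [easy|..].
  + intros s Hs'. auto_derive.
    * exists (dphi s); apply Hd; apply Rabs_le; lra.
    * replace (Derive (fun x : R => phi x) s) with (dphi s); [ring|].
      symmetry. apply is_derive_unique, Hd, Rabs_le. lra.
  + intros s Hs'. apply Rmult_le_pos; [|left; apply exp_pos].
    specialize (Hb s ltac:(apply Rabs_le; lra)).
    rewrite Hs. generalize (Rle_abs (dphi s)). lra.
- rewrite Rabs_left in * by lra.
  assert (H : (phi t + c / A) * exp (A * t) <= (phi 0 + c / A) * exp (A * 0)).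
  2:{ rewrite Rmult_0_r, exp_0 in H.
      apply Rmult_le_reg_r with (exp (A * t)); [apply exp_pos|].
      rewrite Rmult_assoc, <- exp_plus.
      replace (A * - t + A * t) with 0 by ring. rewrite exp_0. lra. }
  apply (incr_le (fun s => (phi s + c / A) * exp (A * s))
    (fun s => (A * (phi s + c / A) + dphi s) * exp (A * s))); [lra|..].
  + intros s Hs'. auto_derive.
    * exists (dphi s); apply Hd; apply Rabs_le; lra.
    * replace (Derive (fun x : R => phi x) s) with (dphi s); [ring|].
      symmetry. apply is_derive_unique, Hd, Rabs_le. lra.
  + intros s Hs'. apply Rmult_le_pos; [|left; apply exp_pos].
    specialize (Hb s ltac:(apply Rabs_le; lra)).
    rewrite Hs. generalize (Rle_abs (- dphi s)). rewrite Rabs_Ropp. lra.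
Qed.

Lemma Rabs_RInt_le_const (f : R -> R) (a b M : R) : ex_RInt f a b ->
  (forall t, Rmin a b <= t <= Rmax a b -> Rabs (f t) <= M) ->
  Rabs (RInt f a b) <= Rabs (b - a) * M.
Proof.
intros Hf HM.
apply (norm_RInt_le_const_abs (V := R_NormedModule) f a b); [exact HM|].
now apply (RInt_correct (V := R_CompleteNormedModule)).
Qed.

(** * Integrals depending on a parameter *)

Definition vstrip (a b : R) (p : vec) : Prop := a < fst p < b.

Lemma vstrip_open a b : open (vstrip a b).
Proof.
apply (open_comp (fst : vec -> R) (fun x => a < x < b)).
- intros [x y] _. apply continuous_fst.
- apply open_and; [apply open_gt|apply open_lt].
Qed.

Section ParameterIntegral.

Variables a b : R.

Definition prim (f : vec -> R) (p : vec) : R := RInt (fun s => f (fst p, s)) 0 (snd p).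

Lemma vstrip_continuous_snd f x t :
  Cn_plane 0 (vstrip a b) f -> a < x < b -> continuous (fun s => f (x, s)) t.
Proof.
intros Hf Hx.
apply (continuous_comp (fun s : R => (x, s) : vec) f).
- apply (continuous_comp_2 (fun _ : R => x) (fun s : R => s) (fun u v => (u, v) : vec)).
  + apply continuous_const.
  + apply continuous_id.
  + apply (continuous_ext (fun p : vec => p)); [now intros []|apply continuous_id].
- eapply Cn_plane_continuous; eauto.
Qed.

Lemma vstrip_ex_RInt f x t u :
  Cn_plane 0 (vstrip a b) f -> a < x < b -> ex_RInt (fun s => f (x, s)) t u.
Proof.
intros Hf Hx. apply (ex_RInt_continuous (V := R_CompleteNormedModule)).
intros s _. now apply vstrip_continuous_snd.
Qed.

Lemma is_dy_prim f x t : Cn_plane 0 (vstrip a b) f -> a < x < b ->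
  is_derive (fun s => prim f (x, s)) t (f (x, t)).
Proof.
intros Hf Hx. unfold prim; simpl.
apply (is_derive_RInt (V := R_NormedModule) (fun s => f (x, s)) _ 0).
- apply filter_forall. intros s.
  apply (RInt_correct (V := R_CompleteNormedModule)). now apply vstrip_ex_RInt.
- now apply vstrip_continuous_snd.
Qed.

(** The increment from (x, t) to (u, v) splits into the integral over [0, t] of f(u, s) - f(x, s),
    small by uniform continuity on a closed rectangle, and the integral of f(u, s) over [t, v],
    small because f is bounded there. *)
Lemma prim_continuous f p :
  Cn_plane 0 (vstrip a b) f -> vstrip a b p -> continuous (prim f) p.
Proof.
destruct p as [x t]. unfold vstrip; simpl. intros Hf Hx.
apply continuity_2d_pt_vec. intros eps.
set (r := Rmin (x - a) (b - x) / 2).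
assert (Hr : 0 < r) by (unfold r; apply Rdiv_lt_0_compat; [apply Rmin_pos|]; lra).
assert (Hra : a < x - r) by (unfold r; generalize (Rmin_l (x - a) (b - x)); lra).
assert (Hrb : x + r < b) by (unfold r; generalize (Rmin_r (x - a) (b - x)); lra).
assert (Hc : forall u v, x - r <= u <= x + r -> - (Rabs t + 1) <= v <= Rabs t + 1 ->
  continuous f (u, v)).
{ intros u v Hu Hv. apply (Cn_plane_continuous _ 0 _ _ Hf). unfold vstrip; simpl; lra. }
destruct (rectangle_bounded f _ _ _ _ Hc) as (M & HM & HM').
assert (Ht := Rabs_pos t).
(* The added 1 keeps the denominator positive at t = 0. The rectangle also reaches one unit beyond
   |t|, so that it contains all heights between t and v once |v - t| < 1. *)
assert (He : 0 < eps / (2 * (Rabs t + 1))).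
{ apply Rdiv_lt_0_compat; [apply cond_pos|lra]. }
destruct (uniform_continuity_2d (fun u v => f (u, v)) (x - r) (x + r)
   (- (Rabs t + 1)) (Rabs t + 1)
   (fun u v Hu Hv => proj2 (continuity_2d_pt_vec f u v) (Hc u v Hu Hv)) (mkposreal _ He))
  as [d Hd]; simpl in Hd.
assert (Hm : 0 < Rmin (Rmin d r) (Rmin 1 (eps / (2 * M)))).
{ repeat apply Rmin_pos; try lra; try apply cond_pos.
  apply Rdiv_lt_0_compat; [apply cond_pos|lra]. }
exists (mkposreal _ Hm); simpl. intros u v Hu Hv.
assert (Hu1 : Rabs (u - x) < d).
{ apply Rlt_le_trans with (1 := Hu). eapply Rle_trans; [apply Rmin_l|apply Rmin_l]. }
assert (Hu2 : Rabs (u - x) < r).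
{ apply Rlt_le_trans with (1 := Hu). eapply Rle_trans; [apply Rmin_l|apply Rmin_r]. }
assert (Hv1 : Rabs (v - t) < 1).
{ apply Rlt_le_trans with (1 := Hv). eapply Rle_trans; [apply Rmin_r|apply Rmin_l]. }
assert (Hv2 : Rabs (v - t) < eps / (2 * M)).
{ apply Rlt_le_trans with (1 := Hv). eapply Rle_trans; [apply Rmin_r|apply Rmin_r]. }
apply Rabs_def2 in Hu2.
assert (Hin : a < u < b) by lra.
unfold prim; simpl.
assert (Hch : RInt (fun s => f (u, s)) 0 v =
  RInt (fun s => f (u, s)) 0 t + RInt (fun s => f (u, s)) t v).
{ symmetry. apply (RInt_Chasles (V := R_CompleteNormedModule)); now apply vstrip_ex_RInt. }
rewrite Hch.
assert (Hdiff : RInt (fun s => f (u, s)) 0 t - RInt (fun s => f (x, s)) 0 t =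
  RInt (fun s => f (u, s) - f (x, s)) 0 t).
{ symmetry. apply (RInt_minus (V := R_CompleteNormedModule)); now apply vstrip_ex_RInt. }
assert (H1 : Rabs (RInt (fun s => f (u, s) - f (x, s)) 0 t) <=
  Rabs (t - 0) * (eps / (2 * (Rabs t + 1)))).
{ apply (Rabs_RInt_le_const (fun s => f (u, s) - f (x, s)) 0 t).
  - apply (ex_RInt_minus (V := R_NormedModule)); now apply vstrip_ex_RInt.
  - intros s Hs. left.
    assert (- Rabs t <= s <= Rabs t).
    { revert Hs. unfold Rmin, Rmax. destruct Rle_dec; intros.
      - rewrite Rabs_pos_eq; lra.
      - rewrite Rabs_left; lra. }
    apply Hd; try lra. rewrite Rminus_eq_0, Rabs_R0. apply cond_pos. }
assert (H2 : Rabs (RInt (fun s => f (u, s)) t v) <= Rabs (v - t) * M).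
{ apply Rabs_RInt_le_const; [now apply vstrip_ex_RInt|].
  intros s Hs. apply HM'; [lra|].
  generalize (Rle_abs t) (Rle_abs (- t)). rewrite Rabs_Ropp. intros.
  apply Rabs_def2 in Hv1.
  revert Hs. unfold Rmin, Rmax. destruct Rle_dec; lra. }
rewrite Rminus_0_r in H1.
assert (H3 : Rabs t * (eps / (2 * (Rabs t + 1))) <= eps / 2).
{ apply Rle_trans with ((Rabs t + 1) * (eps / (2 * (Rabs t + 1)))).
  - apply Rmult_le_compat_r; lra.
  - right; field; lra. }
assert (H4 : Rabs (v - t) * M < eps / 2).
{ apply Rlt_le_trans with (eps / (2 * M) * M).
  - now apply Rmult_lt_compat_r.
  - right; field; lra. }
replace (_ - _) with (RInt (fun s => f (u, s) - f (x, s)) 0 t + RInt (fun s => f (u, s)) t v).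
- generalize (Rabs_triang (RInt (fun s => f (u, s) - f (x, s)) 0 t)
     (RInt (fun s => f (u, s)) t v)). lra.
- rewrite <- Hdiff. ring.
Qed.

Lemma is_dx_prim f x t : Cn_plane 1 (vstrip a b) f -> a < x < b ->
  is_derive (fun z => prim f (z, t)) x (prim (dx f) (x, t)).
Proof.
intros Hf Hx. unfold prim; simpl.
assert (Hf0 := Cn_plane_le _ 1 0 _ (Nat.le_0_l 1) Hf).
apply (is_derive_RInt_param (fun z s => f (z, s)) 0 t x).
- generalize (vstrip_open a b (x, 0) Hx). intros [e He]. exists e. intros z Hz s _.
  eexists. eapply Cn_plane_is_dx; [exact Hf|].
  apply (He (z, 0)). split; [exact Hz|apply ball_center].
- intros s _. apply (continuity_2d_pt_vec (dx f)).
  apply (Cn_plane_continuous _ 0 _ _ (Cn_plane_dx _ _ _ Hf)). exact Hx.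
- generalize (vstrip_open a b (x, 0) Hx). intros [e He]. exists e. intros z Hz.
  apply vstrip_ex_RInt; [exact Hf0|].
  apply (He (z, 0)). split; [exact Hz|apply ball_center].
Qed.

(** The partials of [prim f] are [prim (dx f)], covered by the induction hypothesis, and [f]
    itself. *)
Lemma Cn_plane_prim n f : Cn_plane n (vstrip a b) f -> Cn_plane n (vstrip a b) (prim f).
Proof.
revert f; induction n as [|n IH]; intros f Hf.
- apply Cn_plane_0_intro. intros p. now apply prim_continuous.
- assert (Hf0 := Cn_plane_le _ _ 0 _ (Nat.le_0_l (S n)) Hf).
  assert (Hf1 := Cn_plane_le _ _ 1 _ (le_n_S 0 n (Nat.le_0_l n)) Hf).
  apply (Cn_plane_S_intro _ (vstrip_open a b) n _ (prim (dx f)) f).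
  + intros p. now apply prim_continuous.
  + intros x y Hp. now apply is_dx_prim.
  + intros x y Hp. now apply is_dy_prim.
  + now apply IH, Cn_plane_dx.
  + exact (Cn_plane_le _ _ _ _ (Nat.le_succ_diag_r n) Hf).
Qed.

End ParameterIntegral.

(** * Mean value, Taylor and Lipschitz estimates on a closed rectangle *)

Definition rect (x1 x2 y1 y2 : R) (p : vec) : Prop :=
  x1 <= fst p <= x2 /\ y1 <= snd p <= y2.

Definition dist1 (p q : vec) : R := Rabs (fst q - fst p) + Rabs (snd q - snd p).

Section Rectangle.

Variables a b x1 x2 y1 y2 : R.
Hypotheses (Hx1 : a < x1) (Hx2 : x2 < b).

Lemma rect_vstrip p : rect x1 x2 y1 y2 p -> vstrip a b p.
Proof. intros [H _]. unfold vstrip. lra. Qed.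

Lemma rect_segment p q s : rect x1 x2 y1 y2 p -> rect x1 x2 y1 y2 q -> 0 <= s <= 1 ->
  rect x1 x2 y1 y2 (fst p + s * (fst q - fst p), snd p + s * (snd q - snd p)).
Proof. intros [Hp1 Hp2] [Hq1 Hq2] Hs. split; simpl; nra. Qed.

(** One-variable mean value theorem on the segment from p to q, which stays in the convex rectangle.
    The distance from p to the intermediate point is recorded because [rect_taylor] compares the
    gradients at these two points. *)
Lemma plane_mvt f p q : Cn_plane 1 (vstrip a b) f ->
  rect x1 x2 y1 y2 p -> rect x1 x2 y1 y2 q ->
  exists r, rect x1 x2 y1 y2 r /\ dist1 p r <= dist1 p q /\
    f q - f p = dx f r * (fst q - fst p) + dy f r * (snd q - snd p).
Proof.
intros Hf Hp Hq.
set (c := fun s : R => (fst p + s * (fst q - fst p), snd p + s * (snd q - snd p)) : vec).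
destruct (MVT_cor2 (fun s => f (c s))
  (fun s => dx f (c s) * (fst q - fst p) + dy f (c s) * (snd q - snd p)) 0 1 Rlt_0_1)
  as (s & Hs & Hs').
- intros s Hs. apply is_derive_Reals.
  apply (Cn_plane_chain _ (vstrip_open a b) f (fun s => fst p + s * (fst q - fst p))
     (fun s => snd p + s * (snd q - snd p))); auto.
  + now apply (rect_vstrip (c s)), rect_segment.
  + auto_derive; [easy|ring].
  + auto_derive; [easy|ring].
- exists (c s). assert (H01 : 0 <= s <= 1) by lra.
  split; [now apply rect_segment|]. split.
  + unfold dist1, c; simpl.
    replace (fst p + s * (fst q - fst p) - fst p) with (s * (fst q - fst p)) by ring.
    replace (snd p + s * (snd q - snd p) - snd p) with (s * (snd q - snd p)) by ring.
    rewrite 2!Rabs_mult, (Rabs_pos_eq s) by lra.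
    generalize (Rabs_pos (fst q - fst p)) (Rabs_pos (snd q - snd p)). nra.
  + replace (f q) with (f (c 1)).
    2:{ f_equal. unfold c. rewrite (surjective_pairing q) at 3. f_equal; ring. }
    replace (f p) with (f (c 0)).
    2:{ f_equal. unfold c. rewrite (surjective_pairing p) at 5. f_equal; ring. }
    rewrite Hs. ring.
Qed.

Lemma rect_bounded f : Cn_plane 0 (vstrip a b) f ->
  exists M, 0 < M /\ forall p, rect x1 x2 y1 y2 p -> Rabs (f p) <= M.
Proof.
intros Hf. destruct (rectangle_bounded f x1 x2 y1 y2) as (M & HM & HM').
- intros x y Hx Hy. apply (Cn_plane_continuous _ 0 _ _ Hf). now apply rect_vstrip.
- exists M. split; [exact HM|]. intros [x y] [Hx Hy]. now apply HM'.
Qed.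

Lemma rect_lipschitz f : Cn_plane 1 (vstrip a b) f ->
  exists M, 0 < M /\ forall p q, rect x1 x2 y1 y2 p -> rect x1 x2 y1 y2 q ->
    Rabs (f q - f p) <= M * dist1 p q.
Proof.
intros Hf.
destruct (rect_bounded _ (Cn_plane_dx _ _ _ Hf)) as (M & HM & HM').
destruct (rect_bounded _ (Cn_plane_dy _ _ _ Hf)) as (N & HN & HN').
exists (M + N). split; [lra|]. intros p q Hp Hq.
destruct (plane_mvt f p q Hf Hp Hq) as (r & Hr & _ & ->).
eapply Rle_trans; [apply Rabs_triang|]. rewrite 2!Rabs_mult. unfold dist1.
generalize (HM' r Hr) (HN' r Hr) (Rabs_pos (fst q - fst p)) (Rabs_pos (snd q - snd p)).
intros. nra.
Qed.

(** In the mean value formula, the gradient at the intermediate point differs from the gradient at p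
    by at most a Lipschitz constant times [dist1 p q]. *)
Lemma rect_taylor f : Cn_plane 2 (vstrip a b) f ->
  exists M, 0 < M /\ forall p q, rect x1 x2 y1 y2 p -> rect x1 x2 y1 y2 q ->
    Rabs (f q - f p - (dx f p * (fst q - fst p) + dy f p * (snd q - snd p)))
      <= M * dist1 p q ^ 2.
Proof.
intros Hf.
destruct (rect_lipschitz _ (Cn_plane_dx _ _ _ Hf)) as (M & HM & HM').
destruct (rect_lipschitz _ (Cn_plane_dy _ _ _ Hf)) as (N & HN & HN').
exists (M + N). split; [lra|]. intros p q Hp Hq.
assert (Hf1 := Cn_plane_le _ _ 1 _ (Nat.le_succ_diag_r 1) Hf).
destruct (plane_mvt f p q Hf1 Hp Hq) as (r & Hr & Hd & ->).
replace (_ - _) with ((dx f r - dx f p) * (fst q - fst p)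
   + (dy f r - dy f p) * (snd q - snd p)) by ring.
eapply Rle_trans; [apply Rabs_triang|]. rewrite 2!Rabs_mult.
generalize (HM' p r Hp Hr) (HN' p r Hp Hr). intros Ha Hb.
assert (Hp0 : 0 <= dist1 p q).
{ unfold dist1. generalize (Rabs_pos (fst q - fst p)) (Rabs_pos (snd q - snd p)). lra. }
assert (H1 : Rabs (fst q - fst p) <= dist1 p q).
{ unfold dist1. generalize (Rabs_pos (snd q - snd p)). lra. }
assert (H2 : Rabs (snd q - snd p) <= dist1 p q).
{ unfold dist1. generalize (Rabs_pos (fst q - fst p)). lra. }
apply Rle_trans with (M * dist1 p q * dist1 p q + N * dist1 p q * dist1 p q);
  [|right; ring].
apply Rplus_le_compat; apply Rmult_le_compat; try apply Rabs_pos; auto;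
  eapply Rle_trans; try eassumption; apply Rmult_le_compat_l; lra.
Qed.

Lemma dist1_sqr p q :
  dist1 p q ^ 2 <= 2 * ((fst q - fst p) ^ 2 + (snd q - snd p) ^ 2).
Proof.
unfold dist1. rewrite <- (pow2_abs (fst q - fst p)), <- (pow2_abs (snd q - snd p)).
generalize (pow2_ge_0 (Rabs (fst q - fst p) - Rabs (snd q - snd p))). lra.
Qed.

(** Gronwall's estimate is applied to the squared distance, which is differentiable. [C] is fixed
    before the curves: it depends on the field, the rectangle and [T] only, so it serves all
    neighbouring trajectories. Equal initial values give uniqueness. *)
Lemma ode_lipschitz v1 v2 : Cn_plane 1 (vstrip a b) v1 -> Cn_plane 1 (vstrip a b) v2 ->
  forall T, exists C, 0 < C /\ forall c e : R -> vec,
    (forall t, Rabs t <= T -> rect x1 x2 y1 y2 (c t) /\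
       is_derive (fun s => fst (c s)) t (v1 (c t)) /\
       is_derive (fun s => snd (c s)) t (v2 (c t))) ->
    (forall t, Rabs t <= T -> rect x1 x2 y1 y2 (e t) /\
       is_derive (fun s => fst (e s)) t (v1 (e t)) /\
       is_derive (fun s => snd (e s)) t (v2 (e t))) ->
    forall t, Rabs t <= T ->
      (fst (e t) - fst (c t)) ^ 2 + (snd (e t) - snd (c t)) ^ 2 <=
      C * ((fst (e 0) - fst (c 0)) ^ 2 + (snd (e 0) - snd (c 0)) ^ 2).
Proof.
intros Hv1 Hv2 T.
destruct (rect_lipschitz _ Hv1) as (M & HM & HM').
destruct (rect_lipschitz _ Hv2) as (N & HN & HN').
exists (exp (4 * (M + N) * T)). split; [apply exp_pos|].
intros c e Hc He t Ht.
set (X := fun s => fst (e s) - fst (c s)). set (Y := fun s => snd (e s) - snd (c s)).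
set (P := fun s => v1 (e s) - v1 (c s)). set (Q := fun s => v2 (e s) - v2 (c s)).
assert (HX : forall s, Rabs s <= T -> is_derive X s (P s)).
{ intros s Hs. apply (is_derive_minus (V := R_NormedModule)); [apply He|apply Hc]; auto. }
assert (HY : forall s, Rabs s <= T -> is_derive Y s (Q s)).
{ intros s Hs. apply (is_derive_minus (V := R_NormedModule)); [apply He|apply Hc]; auto. }
(* Origin of the rate 4 (M + N): with D the l^1 distance, |2 X P + 2 Y Q| <= 2 (M + N) D^2, and D^2
   <= 2 (X^2 + Y^2). *)
assert (Hg := gronwall (fun s => X s ^ 2 + Y s ^ 2)
  (fun s => 2 * X s * P s + 2 * Y s * Q s) (4 * (M + N)) 0 T ltac:(lra)).
assert (Hg' : X t ^ 2 + Y t ^ 2 + 0 / (4 * (M + N)) <=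
  (X 0 ^ 2 + Y 0 ^ 2 + 0 / (4 * (M + N))) * exp (4 * (M + N) * Rabs t)).
{ apply Hg; auto.
  - intros s Hs. apply (is_derive_plus (V := R_NormedModule)).
    + replace (2 * X s * P s) with (INR 2 * P s * X s ^ Nat.pred 2) by (simpl; ring).
      now apply is_derive_pow, HX.
    + replace (2 * Y s * Q s) with (INR 2 * Q s * Y s ^ Nat.pred 2) by (simpl; ring).
      now apply is_derive_pow, HY.
  - intros s Hs.
    assert (Hd := dist1_sqr (c s) (e s)).
    assert (HP := HM' _ _ (proj1 (Hc s Hs)) (proj1 (He s Hs))).
    assert (HQ := HN' _ _ (proj1 (Hc s Hs)) (proj1 (He s Hs))).
    fold (P s) in HP. fold (Q s) in HQ. fold (X s) (Y s) in Hd |- *.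
    set (D := dist1 (c s) (e s)) in *.
    assert (H1 : Rabs (X s) <= D).
    { unfold D, dist1. fold (X s) (Y s). generalize (Rabs_pos (Y s)). lra. }
    assert (H2 : Rabs (Y s) <= D).
    { unfold D, dist1. fold (X s) (Y s). generalize (Rabs_pos (X s)). lra. }
    eapply Rle_trans; [apply Rabs_triang|].
    rewrite !Rabs_mult, (Rabs_pos_eq 2) by lra.
    apply Rle_trans with (2 * D * (M * D) + 2 * D * (N * D)).
    + generalize (Rabs_pos (X s)) (Rabs_pos (Y s)) (Rabs_pos (P s)) (Rabs_pos (Q s)). intros.
      apply Rplus_le_compat; apply Rmult_le_compat; try lra.
    + assert (H3 : 2 * (M + N) * D ^ 2 <= 2 * (M + N) * (2 * (X s ^ 2 + Y s ^ 2))).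
      { apply Rmult_le_compat_l; lra. }
      lra. }
unfold Rdiv in Hg'. rewrite Rmult_0_l, !Rplus_0_r in Hg'.
fold (X t) (Y t) (X 0) (Y 0).
apply Rle_trans with (1 := Hg'). rewrite Rmult_comm.
apply Rmult_le_compat_r; [generalize (pow2_ge_0 (X 0)) (pow2_ge_0 (Y 0)); lra|].
assert (Hle : 4 * (M + N) * Rabs t <= 4 * (M + N) * T) by (apply Rmult_le_compat_l; lra).
destruct Hle as [Hlt|Heq]; [left; now apply exp_increasing|rewrite Heq; lra].
Qed.

End Rectangle.

(** The time is the supremum of those up to which [phi] stays positive; continuity excludes both
    signs of [phi] there. *)
Lemma first_zero (phi : R -> R) (t1 : R) : (forall t, continuous phi t) ->
  0 < phi 0 -> 0 <= t1 -> phi t1 <= 0 ->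
  exists t, 0 < t <= t1 /\ phi t = 0 /\ forall s, 0 <= s < t -> 0 < phi s.
Proof.
intros Hc H0 Ht1 H1.
set (E := fun t => 0 <= t <= t1 /\ forall s, 0 <= s <= t -> 0 < phi s).
assert (HE0 : E 0).
{ split; [lra|]. intros s Hs. now replace s with 0 by lra. }
destruct (completeness E) as [t [Hub Hlub]].
- exists t1. intros s Hs. apply Hs.
- now exists 0.
- assert (Ht0 : 0 <= t) by now apply Hub.
  assert (Htt : t <= t1) by (apply Hlub; intros s Hs; apply Hs).
  assert (Hbelow : forall s, 0 <= s < t -> 0 < phi s).
  { intros s Hs. apply NNPP. intros Hn.
    assert (t <= s); [|lra]. apply Hlub. intros r [Hr Hr'].
    apply Rnot_lt_le. intros Hsr. apply Hn, Hr'. lra. }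
  assert (Hloc : forall e : posreal, exists eta : posreal, forall s,
     Rabs (s - t) < eta -> Rabs (phi s - phi t) < e).
  { intros e. apply (Hc t (fun z => Rabs (z - phi t) < e)). now exists e. }
  assert (Hz : phi t = 0).
  { destruct (Rtotal_order (phi t) 0) as [Hn|[He|Hp]]; [|easy|].
    - exfalso. destruct (Hloc (mkposreal (- phi t) ltac:(lra))) as [eta Heta]. simpl in Heta.
      assert (t <> 0) by (intros ->; lra).
      assert (Hpos := cond_pos eta).
      set (s := Rmax 0 (t - eta / 2)).
      assert (Hs : 0 <= s < t) by (unfold s, Rmax; destruct Rle_dec; lra).
      assert (Hs2 : Rabs (s - t) < eta).
      { apply Rabs_def1; unfold s, Rmax; destruct Rle_dec; lra. }
      specialize (Heta s Hs2). apply Rabs_def2 in Heta.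
      specialize (Hbelow s Hs). lra.
    - exfalso. destruct (Hloc (mkposreal (phi t) Hp)) as [eta Heta]. simpl in Heta.
      assert (Hpos := cond_pos eta).
      assert (t <> t1) by (intros ->; lra).
      set (s := Rmin t1 (t + eta / 2)).
      assert (Hs : t < s <= t1) by (unfold s, Rmin; destruct Rle_dec; lra).
      assert (Hs2 : s <= t + eta / 2) by apply Rmin_r.
      assert (s <= t); [|lra]. apply Hub. split; [lra|].
      intros r Hr. destruct (Rlt_le_dec r t) as [Hrt|Hrt]; [apply Hbelow; lra|].
      specialize (Heta r ltac:(apply Rabs_def1; lra)). apply Rabs_def2 in Heta. lra. }
  exists t. split; [|now split]. split; [|easy].
  destruct Ht0 as [Hlt|He]; [easy|]. rewrite <- He in Hz. lra.
Qed.

(** * Regularity of the flow *)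

(** The hypothesis is squared because Gronwall's estimate bounds a sum of squares by a multiple of
    h^4. The root of C is avoided through C <= (|C| + 1)^2. *)
Lemma is_derive_quadratic (f : R -> R) (x D C r : R) : 0 < r ->
  (forall h, Rabs h < r -> (f (x + h) - f x - h * D) ^ 2 <= C * h ^ 4) ->
  is_derive f x D.
Proof.
intros Hr H. apply is_derive_Reals. intros e He.
assert (HC : 0 <= Rabs C) by apply Rabs_pos.
assert (Hm : 0 < Rmin r (e / (Rabs C + 1))).
{ apply Rmin_pos; [easy|]. apply Rdiv_lt_0_compat; lra. }
exists (mkposreal _ Hm). simpl. intros h Hh0 Hh.
assert (Hhr : Rabs h < r) by (eapply Rlt_le_trans; [exact Hh|apply Rmin_l]).
assert (Hhe : Rabs h < e / (Rabs C + 1)) by (eapply Rlt_le_trans; [exact Hh|apply Rmin_r]).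
specialize (H h Hhr).
assert (Habs : Rabs (f (x + h) - f x - h * D) <= (Rabs C + 1) * h ^ 2).
{ rewrite <- (Rabs_pos_eq ((Rabs C + 1) * h ^ 2)).
  2:{ apply Rmult_le_pos; [lra|apply pow2_ge_0]. }
  apply Rsqr_le_abs_0. rewrite 2!Rsqr_pow2.
  apply Rle_trans with (1 := H).
  replace (((Rabs C + 1) * h ^ 2) ^ 2) with ((Rabs C + 1) ^ 2 * (h ^ 2) ^ 2) by ring.
  replace (C * h ^ 4) with (C * (h ^ 2) ^ 2) by ring.
  apply Rmult_le_compat_r; [apply pow2_ge_0|].
  generalize (Rle_abs C). nra. }
assert (Hh' : 0 < Rabs h) by now apply Rabs_pos_lt.
replace ((f (x + h) - f x) / h - D) with ((f (x + h) - f x - h * D) / h) by now field.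
unfold Rdiv. rewrite Rabs_mult, Rabs_inv.
apply Rle_lt_trans with ((Rabs C + 1) * h ^ 2 * / Rabs h).
{ apply Rmult_le_compat_r; [left; now apply Rinv_0_lt_compat|easy]. }
rewrite <- pow2_abs. replace (_ * / _) with (Rabs h * (Rabs C + 1)) by (field; lra).
apply Rlt_le_trans with (e / (Rabs C + 1) * (Rabs C + 1)).
- apply Rmult_lt_compat_r; lra.
- right. field. lra.
Qed.

(** * Shape of the trajectories in the left half of the strip *)

Section Flow.

Variables (eps b l : R) (v1 v2 : vec -> R) (F : R -> R -> vec).

Let W := vstrip (- eps) b.
Let E := vstrip 0 b.

Hypotheses (eps_gt0 : 0 < eps)
  (v1_C3 : Cn_plane 3 W v1) (v2_C3 : Cn_plane 3 W v2)
  (v_unit : forall p, W p -> v1 p ^ 2 + v2 p ^ 2 = 1)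
  (v2_gt0 : forall p, W p -> 0 < v2 p)
  (v1_wall : forall y, v1 (0, y) = 0)
  (v1_low : forall x y, 0 < x < b -> y < l -> 0 < v1 (x, y))
  (v1_high : forall x y, 0 < x < b -> l < y -> v1 (x, y) < 0)
  (F_0 : forall x, 0 < x < b -> F x 0 = (x, l))
  (F_1 : forall x t, 0 < x < b -> is_derive (fun s => fst (F x s)) t (v1 (F x t)))
  (F_2 : forall x t, 0 < x < b -> is_derive (fun s => snd (F x s)) t (v2 (F x t))).

(* The two signs of [sg] treat positive and negative times simultaneously. *)
Lemma flow_sign_derive (sg : R) x t : 0 < x < b ->
  is_derive (fun s => fst (F x (sg * s))) t (sg * v1 (F x (sg * t))) /\
  is_derive (fun s => snd (F x (sg * s))) t (sg * v2 (F x (sg * t))).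
Proof.
intros Hx. assert (Hs : is_derive (fun s => sg * s) t sg) by (auto_derive; [easy|ring]).
split.
- now apply (is_derive_comp (fun s => fst (F x s)) (fun s => sg * s)); [apply F_1|].
- now apply (is_derive_comp (fun s => snd (F x s)) (fun s => sg * s)); [apply F_2|].
Qed.

Lemma W_v2_le1 p : W p -> v2 p <= 1.
Proof. intros Hp. generalize (v_unit p Hp) (v2_gt0 p Hp). nra. Qed.

(* As long as the trajectory stays in the strip, its height moves away from [l], hence its
   abscissa decreases. *)
Lemma flow_monotone sg x t m : sg = 1 \/ sg = -1 -> 0 < x < b -> 0 <= t -> m < b ->
  (forall s, 0 <= s < t -> 0 < fst (F x (sg * s)) < m) ->
  fst (F x (sg * t)) <= x /\
  (forall s, 0 <= s <= t ->
    Rmax 0 (s + fst (F x (sg * s)) - x) <= sg * (snd (F x (sg * s)) - l) <= s).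
Proof.
intros Hsg Hx Ht Hm Hin.
assert (HW : forall s, 0 <= s < t -> W (F x (sg * s))).
{ intros s Hs. specialize (Hin s Hs). unfold W, vstrip. lra. }
assert (Hsq : sg * sg = 1) by (destruct Hsg; subst; ring).
set (z := fun s => sg * (snd (F x (sg * s)) - l)).
assert (Hz : forall s, is_derive z s (v2 (F x (sg * s)))).
{ intros s. destruct (flow_sign_derive sg x s Hx) as [_ H].
  unfold z. evar_last.
  - apply is_derive_scal. apply (is_derive_minus (V := R_NormedModule)); [exact H|].
    apply (is_derive_const (V := R_NormedModule)).
  - simpl. unfold minus, plus, opp, zero; simpl.
    replace (sg * (sg * v2 (F x (sg * s)) + - 0)) with (sg * sg * v2 (F x (sg * s))) by ring.
    rewrite Hsq. ring. }
assert (Hz0 : z 0 = 0).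
{ unfold z. rewrite Rmult_0_r, F_0 by easy. simpl. ring. }
assert (Hzpos : forall s, 0 < s <= t -> 0 < z s).
{ intros s Hs. rewrite <- Hz0. apply (incr_lt z (fun s => v2 (F x (sg * s)))); [lra|auto|].
  intros r Hr. apply v2_gt0, HW. lra. }
assert (Hdx : forall s, 0 < s < t -> sg * v1 (F x (sg * s)) < 0).
{ intros s Hs. assert (Hz' := Hzpos s ltac:(lra)). unfold z in Hz'.
  specialize (Hin s ltac:(lra)). destruct (F x (sg * s)) as [X Y]. simpl in *.
  destruct Hsg as [->| ->].
  - generalize (v1_high X Y ltac:(lra) ltac:(lra)). lra.
  - generalize (v1_low X Y ltac:(lra) ltac:(lra)). lra. }
split.
- destruct Ht as [Ht|<-].
  + apply Ropp_le_cancel.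
    replace (- x) with (- fst (F x (sg * 0))).
    2:{ rewrite Rmult_0_r, F_0 by easy. reflexivity. }
    apply (incr_le (fun s => - fst (F x (sg * s))) (fun s => - (sg * v1 (F x (sg * s))))).
    * lra.
    * intros s _. apply (is_derive_opp (V := R_NormedModule)). now apply flow_sign_derive.
    * intros s Hs. specialize (Hdx s Hs). lra.
  + rewrite Rmult_0_r, F_0 by easy. simpl. lra.
- intros s Hs. fold (z s). split; [apply Rmax_lub|].
  + destruct (proj1 Hs) as [H|H]; [left; apply Hzpos; lra|rewrite <- H; lra].
  (* A unit vector satisfies |v1| + |v2| >= 1, and here sg v1 < 0 < v2: the height gained plus the
     abscissa lost is at least the elapsed time. *)
  + assert (H : z 0 - 0 - fst (F x (sg * 0)) <= z s - s - fst (F x (sg * s))).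
    2:{ rewrite Hz0, Rmult_0_r, F_0 in H by easy. simpl in H. lra. }
    apply (incr_le (fun s => z s - s - fst (F x (sg * s)))
      (fun s => v2 (F x (sg * s)) - 1 - sg * v1 (F x (sg * s)))); [lra|..].
    * intros r _. apply (is_derive_minus (V := R_NormedModule)); [|now apply flow_sign_derive].
      apply (is_derive_minus (V := R_NormedModule)); [apply Hz|].
      exact (is_derive_id (K := R_AbsRing) r).
    * intros r Hr. specialize (Hdx r ltac:(lra)).
      assert (Hp := HW r ltac:(lra)).
      generalize (v_unit _ Hp) (v2_gt0 _ Hp). nra.
  + assert (H : 0 - z 0 <= s - z s); [|lra].
    apply (incr_le (fun s => s - z s) (fun s => 1 - v2 (F x (sg * s)))); [lra|..].
    * intros r _. apply (is_derive_minus (V := R_NormedModule)); [|apply Hz].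
      exact (is_derive_id (K := R_AbsRing) r).
    * intros r Hr. generalize (W_v2_le1 _ (HW r ltac:(lra))). lra.
Qed.

(** Barrier argument on X (m - X), with X the abscissa and m the midpoint of x and b: its first zero
    is a contact with one of the two walls. Contact with m contradicts X <= x < m. Contact with 0
    contradicts |v1| <= M X, which follows from v1 = 0 on the wall and makes X exp(M s)
    nondecreasing. *)
Lemma flow_in_strip sg x t : sg = 1 \/ sg = -1 -> 0 < x < b -> 0 <= t ->
  0 < fst (F x (sg * t)) < (x + b) / 2.
Proof.
intros Hsg Hx Ht. set (m := (x + b) / 2).
assert (Hxm : x < m < b) by (unfold m; lra).
set (X := fun s => fst (F x (sg * s))).
assert (Hd : forall s, is_derive X s (sg * v1 (F x (sg * s)))).
{ intros s. now apply flow_sign_derive. }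
assert (Hin : forall r, 0 < r * (m - r) -> 0 < r < m) by (intros; nra).
fold (X t). apply Hin, Rnot_le_lt. intros Hle.
destruct (first_zero (fun s => X s * (m - X s)) t) as (s & Hs & Hs0 & Hbefore); auto.
- intros s. apply (ex_derive_continuous (V := R_NormedModule)).
  eexists. apply (is_derive_mult X); [apply Hd|..|exact Rmult_comm].
  apply (is_derive_minus (V := R_NormedModule)); [|apply Hd].
  apply (is_derive_const (V := R_NormedModule)).
- unfold X. rewrite Rmult_0_r, F_0 by easy. simpl. apply Rmult_lt_0_compat; lra.
- assert (Hb : forall r, 0 <= r < s -> 0 < X r < m) by (intros; apply Hin; auto).
  destruct (flow_monotone sg x s m Hsg Hx ltac:(lra) ltac:(lra) Hb) as [Hxs Hzs].
  fold (X s) in Hxs.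
  assert (HX0 : X s = 0).
  { apply Rmult_integral in Hs0. destruct Hs0; [easy|lra]. }
  destruct (rect_lipschitz (- eps) b 0 m (l - s) (l + s) ltac:(lra) ltac:(lra) v1)
    as (M & HM & HM').
  { apply (Cn_plane_le _ 3 1); [auto|exact v1_C3]. }
  assert (Hlow : X 0 * exp (M * 0) <= X s * exp (M * s)).
  { apply (incr_le (fun r => X r * exp (M * r))
      (fun r => (sg * v1 (F x (sg * r)) + M * X r) * exp (M * r))); [lra|..].
    - intros r _. evar_last.
      + apply (is_derive_mult X (fun r => exp (M * r)) r (sg * v1 (F x (sg * r)))
          (M * exp (M * r))); [apply Hd| |exact Rmult_comm].
        auto_derive; [easy|ring].
      + unfold plus, mult; simpl. ring.
    - intros r Hr. apply Rmult_le_pos; [|left; apply exp_pos].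
      specialize (Hzs r ltac:(lra)). specialize (Hb r ltac:(lra)).
      assert (Habs : l - s <= snd (F x (sg * r)) <= l + s).
      { generalize (Rmax_l 0 (r + fst (F x (sg * r)) - x)).
        destruct Hsg as [->| ->]; lra. }
      assert (Hv := HM' (0, snd (F x (sg * r))) (F x (sg * r))).
      rewrite v1_wall, Rminus_0_r in Hv. unfold dist1 in Hv. simpl in Hv.
      rewrite Rminus_0_r, Rminus_eq_0, Rabs_R0, Rplus_0_r in Hv.
      fold (X r) in Hv. rewrite (Rabs_pos_eq (X r)) in Hv by lra.
      assert (Hv' : Rabs (v1 (F x (sg * r))) <= M * X r).
      { apply Hv; unfold rect; simpl; fold (X r); lra. }
      assert (- Rabs (v1 (F x (sg * r))) <= sg * v1 (F x (sg * r))).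
      { generalize (Rle_abs (v1 (F x (sg * r)))) (Rle_abs (- v1 (F x (sg * r)))).
        rewrite Rabs_Ropp. destruct Hsg as [->| ->]; lra. }
      lra. }
  rewrite HX0, Rmult_0_l, Rmult_0_r, exp_0 in Hlow.
  unfold X in Hlow. rewrite Rmult_0_r, F_0 in Hlow by easy. simpl in Hlow. lra.
Qed.

Lemma flow_signed_bounds sg x t : sg = 1 \/ sg = -1 -> 0 < x < b -> 0 <= t ->
  0 < fst (F x (sg * t)) <= x /\ Rmax 0 (t - x) <= sg * (snd (F x (sg * t)) - l) <= t.
Proof.
intros Hsg Hx Ht.
destruct (flow_monotone sg x t ((x + b) / 2) Hsg Hx Ht ltac:(lra)) as [H1 H2].
- intros s Hs. apply flow_in_strip; auto; lra.
- assert (H3 := flow_in_strip sg x t Hsg Hx Ht). specialize (H2 t ltac:(lra)).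
  split; [lra|split; [apply Rmax_lub|lra]];
    generalize (Rmax_l 0 (t + fst (F x (sg * t)) - x))
      (Rmax_r 0 (t + fst (F x (sg * t)) - x)); lra.
Qed.

Lemma flow_fst x t : 0 < x < b -> 0 < fst (F x t) <= x.
Proof.
intros Hx. destruct (Rle_dec 0 t) as [Ht|Ht].
- rewrite <- (Rmult_1_l t). apply flow_signed_bounds; auto.
- replace t with (-1 * - t) by ring. apply flow_signed_bounds; auto; lra.
Qed.

Lemma flow_snd x t : 0 < x < b ->
  (0 <= t -> Rmax 0 (t - x) <= snd (F x t) - l <= t) /\
  (t <= 0 -> Rmax 0 (- t - x) <= l - snd (F x t) <= - t).
Proof.
intros Hx. split; intros Ht.
- assert (H := flow_signed_bounds 1 x t (or_introl eq_refl) Hx Ht).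
  rewrite !Rmult_1_l in H. apply H.
- assert (H := flow_signed_bounds (-1) x (- t) (or_intror eq_refl) Hx ltac:(lra)).
  replace (-1 * - t) with t in H by ring. lra.
Qed.

Lemma flow_rect x t T : 0 < x < b -> Rabs t <= T ->
  forall m, x <= m -> rect 0 m (l - T) (l + T) (F x t).
Proof.
intros Hx Ht m Hm. apply Rabs_le_between in Ht.
destruct (flow_snd x t Hx) as [H1 H2]. generalize (flow_fst x t Hx).
unfold rect. destruct (Rle_dec 0 t) as [H|H].
- specialize (H1 H). generalize (Rmax_l 0 (t - x)). lra.
- specialize (H2 ltac:(lra)). generalize (Rmax_l 0 (- t - x)). lra.
Qed.

Lemma flow_W x t : 0 < x < b -> W (F x t).
Proof. intros Hx. generalize (flow_fst x t Hx). unfold W, vstrip. lra. Qed.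

Lemma flow_snd_incr x s t : 0 < x < b -> s < t -> snd (F x s) < snd (F x t).
Proof.
intros Hx Hst.
apply (incr_lt (fun r => snd (F x r)) (fun r => v2 (F x r))); auto.
intros r _. now apply v2_gt0, flow_W.
Qed.

(** By time T the height has risen by at least T - x = |y - l| + 1, and symmetrically at time - T,
    so y lies in between. The existence is informative so that the inverse height can be defined as
    a function. *)
Lemma flow_snd_onto x y : 0 < x < b -> {t | snd (F x t) = y}.
Proof.
intros Hx. set (T := Rabs (y - l) + x + 1).
assert (HT : 0 < T) by (unfold T; generalize (Rabs_pos (y - l)); lra).
destruct (IVT (fun t => snd (F x t) - y) (- T) T) as (t & _ & Ht).
- intros t. apply continuity_pt_filterlim.
  apply (ex_derive_continuous (V := R_NormedModule) (fun t => snd (F x t) - y)).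
  eexists. apply (is_derive_minus (V := R_NormedModule)); [now apply F_2|].
  apply (is_derive_const (V := R_NormedModule)).
- lra.
- assert (H := proj2 (flow_snd x (- T) Hx) ltac:(lra)).
  generalize (Rmax_r 0 (- - T - x)) (Rle_abs (- (y - l))). rewrite Rabs_Ropp.
  unfold T in *. lra.
- assert (H := proj1 (flow_snd x T Hx) ltac:(lra)).
  generalize (Rmax_r 0 (T - x)) (Rle_abs (y - l)). unfold T in *. lra.
- exists t. lra.
Qed.

(** The field is autonomous, so both time shifts are solutions. They stay in a common rectangle and
    agree at time 0, and [ode_lipschitz] bounds their squared distance by a multiple of 0. *)
Lemma flow_unique x x' s s' : 0 < x < b -> 0 < x' < b -> F x s = F x' s' ->
  forall t, F x (s + t) = F x' (s' + t).
Proof.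
intros Hx Hx' Hs t.
set (m := Rmax x x'). set (T := Rabs s + Rabs s' + Rabs t).
assert (Hm : m < b) by (unfold m, Rmax; destruct Rle_dec; lra).
destruct (ode_lipschitz (- eps) b 0 m (l - T) (l + T) ltac:(lra) Hm v1 v2
  (Cn_plane_le _ 3 1 _ ltac:(auto) v1_C3) (Cn_plane_le _ 3 1 _ ltac:(auto) v2_C3) (Rabs t))
  as (C & HC & HC').
assert (Hshift : forall x s, 0 < x < b -> x <= m -> Rabs s <= Rabs s + Rabs t <= T ->
  forall r, Rabs r <= Rabs t -> rect 0 m (l - T) (l + T) (F x (s + r)) /\
    is_derive (fun r => fst (F x (s + r))) r (v1 (F x (s + r))) /\
    is_derive (fun r => snd (F x (s + r))) r (v2 (F x (s + r)))).
{ intros z q Hz Hzm Hq r Hr.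
  assert (Hd : is_derive (fun r => q + r) r 1) by (auto_derive; [easy|ring]).
  split; [apply flow_rect; auto|split].
  - generalize (Rabs_triang q r). lra.
  - evar_last; [apply (is_derive_comp (fun s => fst (F z s)) (fun r => q + r));
      [now apply F_1|exact Hd]|apply Rmult_1_l].
  - evar_last; [apply (is_derive_comp (fun s => snd (F z s)) (fun r => q + r));
      [now apply F_2|exact Hd]|apply Rmult_1_l]. }
assert (H1 := Rabs_pos s). assert (H2 := Rabs_pos s'). assert (H3 := Rabs_pos t).
assert (H := HC' (fun r => F x (s + r)) (fun r => F x' (s' + r))
  (Hshift x s Hx (Rmax_l _ _) ltac:(unfold T; lra))
  (Hshift x' s' Hx' (Rmax_r _ _) ltac:(unfold T; lra)) t ltac:(lra)).
simpl in H. rewrite !Rplus_0_r, Hs, !Rminus_eq_0 in H.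
set (X := fst (F x' (s' + t)) - fst (F x (s + t))) in H.
set (Y := snd (F x' (s' + t)) - snd (F x (s + t))) in H.
assert (HX : X = 0) by nra. assert (HY : Y = 0) by nra.
unfold X in HX. unfold Y in HY.
apply injective_projections; lra.
Qed.

Lemma flow_fst_continuous x t : 0 < x < b -> continuous (fun s => fst (F x s)) t.
Proof.
intros Hx. apply (ex_derive_continuous (V := R_NormedModule) (fun s => fst (F x s))).
eexists. now apply F_1.
Qed.

Lemma flow_snd_continuous x t : 0 < x < b -> continuous (fun s => snd (F x s)) t.
Proof.
intros Hx. apply (ex_derive_continuous (V := R_NormedModule) (fun s => snd (F x s))).
eexists. now apply F_2.
Qed.

(** [tau] is y_alpha^-1, defined on the whole line because every height is reached; its continuity
    is that of the inverse of a strictly increasing function. *)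
Lemma flow_height_inverse al : 0 < al < b ->
  exists tau : R -> R, (forall y, snd (F al (tau y)) = y) /\
    (forall t, tau (snd (F al t)) = t) /\ forall y, continuous tau y.
Proof.
intros Hal.
set (tau := fun y => proj1_sig (flow_snd_onto al y Hal)).
assert (Htau : forall y, snd (F al (tau y)) = y).
{ intros y. exact (proj2_sig (flow_snd_onto al y Hal)). }
assert (Hlt : forall s t, snd (F al s) < snd (F al t) -> s < t).
{ intros s t Hst. destruct (Rtotal_order s t) as [H|[->|H]]; [easy|lra|].
  generalize (flow_snd_incr al t s Hal H). lra. }
exists tau. split; [exact Htau|]. split.
- intros t. destruct (Rtotal_order (tau (snd (F al t))) t) as [H|[H|H]]; [|easy|];
    apply (flow_snd_incr al _ _ Hal) in H; rewrite Htau in H; lra.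
- intros y. apply continuity_pt_filterlim. intros e He.
  assert (H1 := flow_snd_incr al (tau y - e) (tau y) Hal ltac:(lra)).
  assert (H2 := flow_snd_incr al (tau y) (tau y + e) Hal ltac:(lra)).
  rewrite Htau in H1, H2.
  exists (Rmin (y - snd (F al (tau y - e))) (snd (F al (tau y + e)) - y)).
  split; [apply Rmin_pos; lra|]. intros z [_ Hz]. simpl in *. unfold Rdist in *.
  assert (Hz1 := Rlt_le_trans _ _ _ Hz (Rmin_l _ _)).
  assert (Hz2 := Rlt_le_trans _ _ _ Hz (Rmin_r _ _)).
  apply Rabs_def2 in Hz1. apply Rabs_def2 in Hz2.
  assert (tau y - e < tau z) by (apply Hlt; rewrite Htau; lra).
  assert (tau z < tau y + e) by (apply Hlt; rewrite Htau; lra).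
  apply Rabs_def1; lra.
Qed.

(* Since two distinct trajectories never meet, the horizontal gap between them at equal
   height keeps its sign. *)
Lemma flow_ordered x al t s : 0 < x < al -> al < b -> snd (F al s) = snd (F x t) ->
  fst (F x t) < fst (F al s).
Proof.
intros Hx Hal Hst.
destruct (flow_height_inverse al ltac:(lra)) as (tau & Htau & Htau' & Hc).
set (z := fun r => fst (F al (tau (snd (F x r)))) - fst (F x r)).
assert (Hz0 : z 0 = al - x).
{ unfold z. rewrite (F_0 x) by lra. simpl.
  replace l with (snd (F al 0)) by (rewrite F_0 by lra; reflexivity).
  rewrite Htau', F_0 by lra. reflexivity. }
assert (Hzc : forall r, continuous z r).
{ intros r. apply (continuous_minus (V := R_NormedModule));
    [|apply flow_fst_continuous; lra].
  apply (continuous_comp (fun r => tau (snd (F x r))) (fun s => fst (F al s)));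
    [|apply flow_fst_continuous; lra].
  apply (continuous_comp (fun r => snd (F x r)) tau); [|apply Hc].
  apply flow_snd_continuous; lra. }
rewrite <- (Htau' s), Hst. apply Rlt_0_minus. fold (z t).
apply Rnot_le_lt. intros Hzt.
destruct (IVT_gen_consistent z 0 t 0 Hzc) as (r & _ & Hr).
{ split; [eapply Rle_trans; [apply Rmin_r|easy]|].
  eapply Rle_trans; [|apply Rmax_l]. lra. }
assert (Heq : F x r = F al (tau (snd (F x r)))).
{ apply injective_projections; [unfold z in Hr; lra|now rewrite Htau]. }
(* Followed back for the time r, the meeting point returns to (x, l). The other trajectory is then
   at height l as well, hence at its own starting point (al, l), which forces x = al. *)
assert (H0 := flow_unique x al _ _ ltac:(lra) ltac:(lra) Heq (- r)).
rewrite Rplus_opp_r, F_0 in H0 by lra.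
assert (H1 : tau (snd (F x r)) + - r = 0).
{ rewrite <- (Htau' (_ + _)), <- H0. simpl.
  replace l with (snd (F al 0)) by (rewrite F_0 by lra; reflexivity). apply Htau'. }
rewrite H1, F_0 in H0 by lra. injection H0. lra.
Qed.

Lemma flow_D_alpha d al x t : b = d / 2 -> 0 < x < al -> al < b -> D_alpha d al F (F x t).
Proof.
intros Hb Hx Hal. assert (H := flow_fst x t ltac:(lra)).
split; [lra|]. destruct (flow_snd_onto al (snd (F x t)) ltac:(lra)) as [s Hs].
exists s. split; [easy|]. split; [lra|]. apply flow_ordered; [lra|lra|exact Hs].
Qed.

(** With the continuous inverse height [tau], the existential in [D_alpha] becomes a strict
    inequality between continuous functions. Openness is what the chain rule for functions on
    [D_alpha] relies on. *)
Lemma D_alpha_open d al : b = d / 2 -> 0 < al < b -> open (D_alpha d al F).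
Proof.
intros Hb Hal.
destruct (flow_height_inverse al Hal) as (tau & Htau & Htau' & Hc).
apply (open_ext (fun p : vec => (0 < fst p /\ fst p < b) /\
   0 < fst (F al (tau (snd p))) - fst p)).
- intros [X Y]. unfold D_alpha. rewrite <- Hb. simpl. split.
  + intros [Hp Hp']. split; [easy|]. exists (tau Y). split; [apply Htau|lra].
  + intros [Hp (t & Ht & Hp')]. split; [easy|]. rewrite <- Ht, Htau'. lra.
- apply open_and.
  + exact (vstrip_open 0 b).
  + apply (open_comp (fun p : vec => fst (F al (tau (snd p))) - fst p) (fun z => 0 < z));
      [|apply open_gt].
    intros p _. apply (continuous_minus (V := R_NormedModule)
      (U := prod_UniformSpace R_UniformSpace R_UniformSpace)
      (fun p : vec => fst (F al (tau (snd p)))));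
      [|destruct p; apply continuous_fst].
    apply (continuous_comp (fun p : vec => tau (snd p)) (fun s => fst (F al s)));
      [|now apply flow_fst_continuous].
    apply (continuous_comp (snd : vec -> R) tau); [destruct p; apply continuous_snd|apply Hc].
Qed.

(** Derivative of |v|^2 = 1, valid near p since the strip is open. With [W_unit_dy] it cancels the
    leftover terms in [V_derive], and it yields the orthogonality of b and Db[w]. *)
Lemma W_unit_dx p : W p -> v1 p * dx v1 p + v2 p * dx v2 p = 0.
Proof.
destruct p as [x y]. intros Hp.
assert (H : is_derive (fun z => v1 (z, y) ^ 2 + v2 (z, y) ^ 2) x
  (INR 2 * dx v1 (x, y) * v1 (x, y) ^ 1 + INR 2 * dx v2 (x, y) * v2 (x, y) ^ 1)).
{ apply (is_derive_plus (V := R_NormedModule));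
    apply (is_derive_pow (fun z => _ (z, y)) 2); eapply Cn_plane_is_dx; eauto. }
assert (H0 : is_derive (fun z => v1 (z, y) ^ 2 + v2 (z, y) ^ 2) x 0).
{ apply (is_derive_ext_loc (fun _ => 1)).
  - generalize (locally_2d_1d_const_y _ _ _ (open_locally_2d W x y (vstrip_open _ _) Hp)).
    apply filter_imp. intros z Hz. symmetry. now apply v_unit.
  - apply (is_derive_const (V := R_NormedModule)). }
apply is_derive_unique in H. apply is_derive_unique in H0. rewrite H0 in H.
simpl in H. lra.
Qed.

Lemma W_unit_dy p : W p -> v1 p * dy v1 p + v2 p * dy v2 p = 0.
Proof.
destruct p as [x y]. intros Hp.
assert (H : is_derive (fun z => v1 (x, z) ^ 2 + v2 (x, z) ^ 2) y
  (INR 2 * dy v1 (x, y) * v1 (x, y) ^ 1 + INR 2 * dy v2 (x, y) * v2 (x, y) ^ 1)).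
{ apply (is_derive_plus (V := R_NormedModule));
    apply (is_derive_pow (fun z => _ (x, z)) 2); eapply Cn_plane_is_dy; eauto. }
assert (H0 : is_derive (fun z => v1 (x, z) ^ 2 + v2 (x, z) ^ 2) y 0).
{ apply (is_derive_ext_loc (fun _ => 1)).
  - generalize (locally_2d_1d_const_x _ _ _ (open_locally_2d W x y (vstrip_open _ _) Hp)).
    apply filter_imp. intros z Hz. symmetry. now apply v_unit.
  - apply (is_derive_const (V := R_NormedModule)). }
apply is_derive_unique in H. apply is_derive_unique in H0. rewrite H0 in H.
simpl in H. lra.
Qed.

(** * Continuous dependence on the starting point *)

Definition pull (f : vec -> R) (p : vec) : R := f (F (fst p) (snd p)).

Lemma Cn_plane_pull n f : Cn_plane n E (pull fst) -> Cn_plane n E (pull snd) ->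
  Cn_plane n W f -> Cn_plane n E (pull f).
Proof.
intros H1 H2 Hf.
apply (Cn_plane_comp_vec n W E f (fun p => F (fst p) (snd p))); auto; try apply vstrip_open.
intros p Hp. now apply flow_W.
Qed.

Lemma flow_derive_comp f x t : Cn_plane 1 W f -> 0 < x < b ->
  is_derive (fun s => f (F x s)) t
    (dx f (F x t) * v1 (F x t) + dy f (F x t) * v2 (F x t)).
Proof.
intros Hf Hx.
apply (is_derive_ext (fun s => f (fst (F x s), snd (F x s)))).
{ intros s. now rewrite <- surjective_pairing. }
assert (H := Cn_plane_chain W (vstrip_open _ _) f (fun s => fst (F x s))
  (fun s => snd (F x s)) t (v1 (F x t)) (v2 (F x t)) Hf).
cbv beta in H. rewrite <- surjective_pairing in H. apply H; auto. now apply flow_W.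
Qed.

(** The radius is half the distance from x to the ends of (0, b). One box with right edge x + r < b
    then contains all trajectories with |u - x| < r up to time T, and one constant serves them
    all. *)
Lemma flow_local_lipschitz x T : 0 < x < b ->
  exists r C, 0 < r /\ 0 < x - r /\ x + r < b /\ 0 < C /\
    forall u s, Rabs (u - x) < r -> Rabs s <= T ->
      (fst (F u s) - fst (F x s)) ^ 2 + (snd (F u s) - snd (F x s)) ^ 2 <= C * (u - x) ^ 2.
Proof.
intros Hx. set (r := Rmin x (b - x) / 2).
assert (Hr : 0 < r) by (unfold r; apply Rdiv_lt_0_compat; [apply Rmin_pos|]; lra).
assert (Hra : r < x) by (unfold r; generalize (Rmin_l x (b - x)); lra).
assert (Hrb : x + r < b) by (unfold r; generalize (Rmin_r x (b - x)); lra).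
destruct (ode_lipschitz (- eps) b 0 (x + r) (l - T) (l + T) ltac:(lra) Hrb v1 v2
  (Cn_plane_le _ 3 1 _ ltac:(auto) v1_C3) (Cn_plane_le _ 3 1 _ ltac:(auto) v2_C3) T)
  as (C & HC & HC').
exists r, C. repeat (split; [lra|]). intros u s Hu Hs. apply Rabs_def2 in Hu.
assert (H : forall z, 0 < z <= x + r -> forall t, Rabs t <= T ->
  rect 0 (x + r) (l - T) (l + T) (F z t) /\
  is_derive (fun s => fst (F z s)) t (v1 (F z t)) /\
  is_derive (fun s => snd (F z s)) t (v2 (F z t))).
{ intros z Hz t Ht. split; [apply flow_rect; lra|].
  split; [apply F_1|apply F_2]; lra. }
specialize (HC' _ _ (H x ltac:(lra)) (H u ltac:(lra)) s Hs).
simpl in HC'. rewrite (F_0 x), (F_0 u) in HC' by lra. simpl in HC'.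
apply Rle_trans with (1 := HC'). right. ring.
Qed.

(** Joint continuity combines a Lipschitz bound in x, uniform for |s| <= |t| + 1, with continuity in
    time at the fixed x. Both coordinates are treated at once as 1-Lipschitz functions [pr]. *)
Lemma flow_C0 : Cn_plane 0 E (pull fst) /\ Cn_plane 0 E (pull snd).
Proof.
assert (H : forall pr : vec -> R,
  (forall x t, 0 < x < b -> continuous (fun s => pr (F x s)) t) ->
  (forall p q, (pr p - pr q) ^ 2 <= (fst p - fst q) ^ 2 + (snd p - snd q) ^ 2) ->
  Cn_plane 0 E (pull pr)).
{ intros pr Hc Hpr x t Hx. split; [|exact I]. intros e.
  destruct (flow_local_lipschitz x (Rabs t + 1) Hx) as (r & C & Hr & H1 & H2 & HC & Hl).
  destruct (Hc x t Hx (fun z => Rabs (z - pr (F x t)) < e / 2)) as [d Hd].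
  { exists (mkposreal _ (is_pos_div_2 e)). now simpl. }
  assert (Hm : 0 < Rmin (Rmin r (e / (2 * (C + 1)))) (Rmin d 1)).
  { repeat apply Rmin_pos; try lra; try apply cond_pos.
    apply Rdiv_lt_0_compat; [apply cond_pos|lra]. }
  exists (mkposreal _ Hm). simpl. intros u v Hu Hv. unfold pull. simpl.
  assert (Hu1 : Rabs (u - x) < r).
  { apply Rlt_le_trans with (1 := Hu). eapply Rle_trans; apply Rmin_l. }
  assert (Hu2 : Rabs (u - x) < e / (2 * (C + 1))).
  { apply Rlt_le_trans with (1 := Hu). eapply Rle_trans; [apply Rmin_l|apply Rmin_r]. }
  assert (Hv1 : Rabs (v - t) < d).
  { apply Rlt_le_trans with (1 := Hv). eapply Rle_trans; [apply Rmin_r|apply Rmin_l]. }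
  assert (Hv2 : Rabs (v - t) < 1).
  { apply Rlt_le_trans with (1 := Hv). eapply Rle_trans; [apply Rmin_r|apply Rmin_r]. }
  specialize (Hd v Hv1). simpl in Hd.
  assert (Hv3 : Rabs v <= Rabs t + 1).
  { replace v with (t + (v - t)) by ring. generalize (Rabs_triang t (v - t)). lra. }
  specialize (Hl u v Hu1 Hv3). specialize (Hpr (F u v) (F x v)).
  assert (Hdiff : Rabs (pr (F u v) - pr (F x v)) <= (C + 1) * Rabs (u - x)).
  { rewrite <- (Rabs_pos_eq (C + 1)), <- Rabs_mult by lra.
    apply Rsqr_le_abs_0. rewrite 2!Rsqr_pow2, Rpow_mult_distr.
    apply Rle_trans with (1 := Hpr). apply Rle_trans with (1 := Hl).
    apply Rmult_le_compat_r; [apply pow2_ge_0|nra]. }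
  assert (Hlt : (C + 1) * Rabs (u - x) < e / 2).
  { apply Rlt_le_trans with ((C + 1) * (e / (2 * (C + 1)))).
    - apply Rmult_lt_compat_l; lra.
    - right. field. lra. }
  replace (pr (F u v) - pr (F x t))
    with ((pr (F u v) - pr (F x v)) + (pr (F x v) - pr (F x t))) by ring.
  eapply Rle_lt_trans; [apply Rabs_triang|]. lra. }
split; apply H.
- intros. now apply flow_fst_continuous.
- intros p q. generalize (pow2_ge_0 (snd p - snd q)). lra.
- intros. now apply flow_snd_continuous.
- intros p q. generalize (pow2_ge_0 (fst p - fst q)). lra.
Qed.

(* The solution of the variational equation along the trajectory through [(x, l)], with
   initial value [(1, 0)], is [mu v + nu n], where [n = (- v2, v1)]. Both [v] along the
   trajectory and the sought solution solve the variational equation, so their determinant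
   [nu] satisfies Liouville's formula; since [|v| = 1], the coefficient [mu] satisfies
   [mu' = nu * curl v]. *)
Definition nu (p : vec) : R :=
  - v2 (fst p, l) * exp (prim (pull (fun q => dx v1 q + dy v2 q)) p).
Definition mu (p : vec) : R :=
  v1 (fst p, l) + prim (fun q => nu q * pull (fun r => dx v2 r - dy v1 r) q) p.
Definition V1 (p : vec) : R := mu p * pull v1 p - nu p * pull v2 p.
Definition V2 (p : vec) : R := mu p * pull v2 p + nu p * pull v1 p.

Lemma nu_neq0 p : E p -> nu p <> 0.
Proof.
intros Hp. unfold nu.
assert (H : 0 < v2 (fst p, l)).
{ apply v2_gt0. unfold E, W, vstrip in *. simpl. lra. }
generalize (exp_pos (prim (pull (fun q => dx v1 q + dy v2 q)) p)). nra.
Qed.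

(** * Regularity of the candidate derivative and its identification with [S1] *)

Section VariationalClass.

Variable n : nat.
Hypotheses (n_le2 : (n <= 2)%nat)
  (F1_Cn : Cn_plane n E (pull fst)) (F2_Cn : Cn_plane n E (pull snd)).

Let E_open : open E := vstrip_open 0 b.

Lemma Cn_plane_initial f : Cn_plane n W f -> Cn_plane n E (fun p => f (fst p, l)).
Proof.
intros Hf. apply (Cn_plane_comp n W E); auto; try apply vstrip_open.
- unfold E, W, vstrip. simpl. intros. lra.
- now apply Cn_plane_fst.
- now apply Cn_plane_const.
Qed.

Lemma Cn_v : Cn_plane n W v1 /\ Cn_plane n W v2.
Proof. split; apply (Cn_plane_le _ 3); auto. Qed.

Lemma Cn_dv f : Cn_plane 3 W f -> Cn_plane n W (dx f) /\ Cn_plane n W (dy f).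
Proof.
intros Hf. split; apply (Cn_plane_le _ 2); auto; [now apply Cn_plane_dx|now apply Cn_plane_dy].
Qed.

Lemma Cn_tr : Cn_plane n E (pull (fun q => dx v1 q + dy v2 q)).
Proof.
apply Cn_plane_pull; auto. apply Cn_plane_plus; [apply vstrip_open|now apply Cn_dv..].
Qed.

Lemma Cn_nu : Cn_plane n E nu.
Proof.
apply Cn_plane_mult; auto.
- apply Cn_plane_opp; auto. apply Cn_plane_initial, Cn_v.
- apply Cn_plane_exp; auto. apply Cn_plane_prim, Cn_tr.
Qed.

Lemma Cn_nu_curl : Cn_plane n E (fun q => nu q * pull (fun r => dx v2 r - dy v1 r) q).
Proof.
apply Cn_plane_mult; auto; [apply Cn_nu|]. apply Cn_plane_pull; auto.
apply Cn_plane_plus; [apply vstrip_open|now apply Cn_dv|].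
apply Cn_plane_opp; [apply vstrip_open|now apply Cn_dv].
Qed.

Lemma Cn_mu : Cn_plane n E mu.
Proof.
apply Cn_plane_plus; auto; [apply Cn_plane_initial, Cn_v|].
apply Cn_plane_prim, Cn_nu_curl.
Qed.

Lemma Cn_V : Cn_plane n E V1 /\ Cn_plane n E V2.
Proof.
assert (Hv1 : Cn_plane n E (pull v1)) by (apply Cn_plane_pull; auto; apply Cn_v).
assert (Hv2 : Cn_plane n E (pull v2)) by (apply Cn_plane_pull; auto; apply Cn_v).
split; apply Cn_plane_plus; auto; try apply Cn_plane_opp; auto;
  apply Cn_plane_mult; auto; apply Cn_mu || apply Cn_nu.
Qed.

End VariationalClass.

Lemma nu_derive x t : 0 < x < b ->
  is_derive (fun s => nu (x, s)) t (nu (x, t) * (dx v1 (F x t) + dy v2 (F x t))).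
Proof.
intros Hx. destruct flow_C0 as [H1 H2].
assert (H := is_dy_prim 0 b _ x t (Cn_tr 0 ltac:(auto) H1 H2) Hx).
unfold nu at 1. simpl. evar_last.
- apply is_derive_scal. apply (is_derive_comp exp); [apply is_derive_exp|exact H].
- unfold nu, pull, scal, mult; simpl. unfold mult; simpl. ring.
Qed.

Lemma mu_derive x t : 0 < x < b ->
  is_derive (fun s => mu (x, s)) t (nu (x, t) * (dx v2 (F x t) - dy v1 (F x t))).
Proof.
intros Hx. destruct flow_C0 as [H1 H2].
assert (H := is_dy_prim 0 b _ x t (Cn_nu_curl 0 ltac:(auto) H1 H2) Hx).
unfold mu. simpl. evar_last.
- apply (is_derive_plus (V := R_NormedModule)); [|exact H].
  apply (is_derive_const (V := R_NormedModule)).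
- unfold pull, plus, zero; simpl. ring.
Qed.

Lemma V_derive x t : 0 < x < b ->
  is_derive (fun s => V1 (x, s)) t
    (dx v1 (F x t) * V1 (x, t) + dy v1 (F x t) * V2 (x, t)) /\
  is_derive (fun s => V2 (x, s)) t
    (dx v2 (F x t) * V1 (x, t) + dy v2 (F x t) * V2 (x, t)).
Proof.
intros Hx.
assert (Hnu := nu_derive x t Hx). assert (Hmu := mu_derive x t Hx).
assert (H1 := flow_derive_comp v1 x t (Cn_plane_le _ 3 1 _ ltac:(auto) v1_C3) Hx).
assert (H2 := flow_derive_comp v2 x t (Cn_plane_le _ 3 1 _ ltac:(auto) v2_C3) Hx).
assert (Ux := W_unit_dx _ (flow_W x t Hx)).
assert (Uy := W_unit_dy _ (flow_W x t Hx)).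
unfold V1, V2, pull. simpl. split; evar_last.
- apply (is_derive_minus (V := R_NormedModule)).
  + apply (is_derive_mult (fun s => mu (x, s)) (fun s => v1 (F x s)));
      [exact Hmu|exact H1|exact Rmult_comm].
  + apply (is_derive_mult (fun s => nu (x, s)) (fun s => v2 (F x s)));
      [exact Hnu|exact H2|exact Rmult_comm].
- unfold minus, plus, opp, mult; simpl.
  (* The terms in mu cancel by the chain rule along the trajectory. The two sides then differ by 2
     nu (v1 dy v1 + v2 dy v2) up to sign, hence the multiplication by nu; for the second component
     the relation in dx plays this part. *)
  apply (f_equal (Rmult (nu (x, t)))) in Uy. nsatz.
- apply (is_derive_plus (V := R_NormedModule)).
  + apply (is_derive_mult (fun s => mu (x, s)) (fun s => v2 (F x s)));
      [exact Hmu|exact H2|exact Rmult_comm].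
  + apply (is_derive_mult (fun s => nu (x, s)) (fun s => v1 (F x s)));
      [exact Hnu|exact H1|exact Rmult_comm].
- unfold minus, plus, opp, mult; simpl.
  nsatz.
Qed.

(** At time 0, mu and nu are v1 and - v2 at (x, l), the components of (1, 0) in the orthonormal
    frame (v, n). *)
Lemma V_initial x : 0 < x < b -> V1 (x, 0) = 1 /\ V2 (x, 0) = 0.
Proof.
intros Hx. unfold V1, V2, mu, nu, prim, pull. simpl.
rewrite 2!RInt_point, F_0 by easy. unfold zero; simpl. rewrite exp_0.
assert (H := v_unit (x, l) ltac:(unfold W, vstrip; simpl; lra)). split; lra.
Qed.

(** R = F(x + h) - F(x) - h V solves R' = Dv R + e, where e is the Taylor remainder of v between the
    two trajectories. These stay within O(|h|) of each other, so e = O(h^2), and Gronwall's estimate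
    with R(0) = 0 gives R = O(h^2). *)
Lemma flow_first_order x t : 0 < x < b ->
  exists r C, 0 < r /\ forall h, Rabs h < r ->
    (fst (F (x + h) t) - fst (F x t) - h * V1 (x, t)) ^ 2 +
    (snd (F (x + h) t) - snd (F x t) - h * V2 (x, t)) ^ 2 <= C * h ^ 4.
Proof.
intros Hx. set (T := Rabs t).
destruct (flow_local_lipschitz x T Hx) as (r & C & Hr & Hr1 & Hr2 & HC & Hlip).
assert (Heps : - eps < 0) by lra.
destruct (rect_taylor (- eps) b 0 (x + r) (l - T) (l + T) Heps Hr2 v1) as (N1 & HN1 & HN1').
{ now apply (Cn_plane_le _ 3 2); auto. }
destruct (rect_taylor (- eps) b 0 (x + r) (l - T) (l + T) Heps Hr2 v2) as (N2 & HN2 & HN2').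
{ now apply (Cn_plane_le _ 3 2); auto. }
destruct (Cn_dv 0 ltac:(auto) v1 v1_C3) as [D1 D2].
destruct (Cn_dv 0 ltac:(auto) v2 v2_C3) as [D3 D4].
destruct (rect_bounded (- eps) b 0 (x + r) (l - T) (l + T) Heps Hr2 _ D1) as (M1 & HM1 & HM1').
destruct (rect_bounded (- eps) b 0 (x + r) (l - T) (l + T) Heps Hr2 _ D2) as (M2 & HM2 & HM2').
destruct (rect_bounded (- eps) b 0 (x + r) (l - T) (l + T) Heps Hr2 _ D3) as (M3 & HM3 & HM3').
destruct (rect_bounded (- eps) b 0 (x + r) (l - T) (l + T) Heps Hr2 _ D4) as (M4 & HM4 & HM4').
(* K h^2 bounds both Taylor remainders, since dist1^2 <= 2 C h^2. With p = |R1| and q = |R2|, 2 (p +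
   q) K h^2 <= p^2 + q^2 + 2 K^2 h^4 and 2 M (p + q)^2 <= 4 M (p^2 + q^2); this gives A = 4 M + 1
   and the constant term 2 K^2 h^4. *)
set (M := M1 + M2 + M3 + M4). set (K := 2 * (N1 + N2) * C). set (A := 4 * M + 1).
assert (HA : 0 < A) by (unfold A, M; lra).
exists r, (2 * K ^ 2 / A * exp (A * T)). split; [exact Hr|]. intros h Hh.
assert (Hu : 0 < x + h <= x + r) by (apply Rabs_def2 in Hh; lra).
set (R1 := fun s => fst (F (x + h) s) - fst (F x s) - h * V1 (x, s)).
set (R2 := fun s => snd (F (x + h) s) - snd (F x s) - h * V2 (x, s)).
set (e1 := fun s => v1 (F (x + h) s) - v1 (F x s) -
  h * (dx v1 (F x s) * V1 (x, s) + dy v1 (F x s) * V2 (x, s))).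
set (e2 := fun s => v2 (F (x + h) s) - v2 (F x s) -
  h * (dx v2 (F x s) * V1 (x, s) + dy v2 (F x s) * V2 (x, s))).
assert (HR1 : forall s, is_derive R1 s (e1 s)).
{ intros s. apply (is_derive_minus (V := R_NormedModule)).
  - apply (is_derive_minus (V := R_NormedModule)); apply F_1; lra.
  - apply is_derive_scal. now apply V_derive. }
assert (HR2 : forall s, is_derive R2 s (e2 s)).
{ intros s. apply (is_derive_minus (V := R_NormedModule)).
  - apply (is_derive_minus (V := R_NormedModule)); apply F_2; lra.
  - apply is_derive_scal. now apply V_derive. }
assert (HK : 0 < K) by (unfold K; apply Rmult_lt_0_compat; lra).
assert (Hbound : forall s, Rabs s <= T ->
  Rabs (e1 s) <= K * h ^ 2 + M * (Rabs (R1 s) + Rabs (R2 s)) /\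
  Rabs (e2 s) <= K * h ^ 2 + M * (Rabs (R1 s) + Rabs (R2 s))).
{ intros s Hs.
  assert (Hp : rect 0 (x + r) (l - T) (l + T) (F x s)) by (apply flow_rect; lra).
  assert (Hq : rect 0 (x + r) (l - T) (l + T) (F (x + h) s)) by (apply flow_rect; lra).
  specialize (HN1' _ _ Hp Hq). specialize (HN2' _ _ Hp Hq).
  specialize (HM1' _ Hp). specialize (HM2' _ Hp).
  specialize (HM3' _ Hp). specialize (HM4' _ Hp).
  assert (Hd := dist1_sqr (F x s) (F (x + h) s)).
  assert (Hl := Hlip (x + h) s). replace (x + h - x) with h in Hl by ring.
  specialize (Hl Hh Hs).
  set (d2 := dist1 (F x s) (F (x + h) s) ^ 2) in *.
  assert (Hd2 : 0 <= d2) by apply pow2_ge_0.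
  assert (Hd3 : d2 <= 2 * C * h ^ 2) by lra.
  assert (HNK : N1 * d2 <= K * h ^ 2 /\ N2 * d2 <= K * h ^ 2).
  { replace (K * h ^ 2) with ((N1 + N2) * (2 * C * h ^ 2)) by (unfold K; ring).
    split; apply Rmult_le_compat; lra. }
  assert (Ha := Rabs_pos (R1 s)). assert (Hb := Rabs_pos (R2 s)).
  assert (Hlin : forall p q, Rabs p <= M -> Rabs q <= M ->
    Rabs (p * R1 s + q * R2 s) <= M * (Rabs (R1 s) + Rabs (R2 s))).
  { intros p q Hp' Hq'. eapply Rle_trans; [apply Rabs_triang|]. rewrite 2!Rabs_mult. nra. }
  split.
  - replace (e1 s) with ((v1 (F (x + h) s) - v1 (F x s) -
      (dx v1 (F x s) * (fst (F (x + h) s) - fst (F x s)) +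
       dy v1 (F x s) * (snd (F (x + h) s) - snd (F x s)))) +
      (dx v1 (F x s) * R1 s + dy v1 (F x s) * R2 s)) by (unfold e1, R1, R2; ring).
    eapply Rle_trans; [apply Rabs_triang|]. apply Rplus_le_compat; [lra|].
    apply Hlin; unfold M; lra.
  - replace (e2 s) with ((v2 (F (x + h) s) - v2 (F x s) -
      (dx v2 (F x s) * (fst (F (x + h) s) - fst (F x s)) +
       dy v2 (F x s) * (snd (F (x + h) s) - snd (F x s)))) +
      (dx v2 (F x s) * R1 s + dy v2 (F x s) * R2 s)) by (unfold e2, R1, R2; ring).
    eapply Rle_trans; [apply Rabs_triang|]. apply Rplus_le_compat; [lra|].
    apply Hlin; unfold M; lra. }
set (c := 2 * K ^ 2 * h ^ 4).
assert (Hg : R1 t ^ 2 + R2 t ^ 2 + c / A <= (R1 0 ^ 2 + R2 0 ^ 2 + c / A) * exp (A * Rabs t)).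
{ apply (gronwall (fun s => R1 s ^ 2 + R2 s ^ 2)
    (fun s => 2 * R1 s * e1 s + 2 * R2 s * e2 s) A c T HA).
  - intros s _. apply (is_derive_plus (V := R_NormedModule)).
    + replace (2 * R1 s * e1 s) with (INR 2 * e1 s * R1 s ^ Nat.pred 2) by (simpl; ring).
      now apply is_derive_pow.
    + replace (2 * R2 s * e2 s) with (INR 2 * e2 s * R2 s ^ Nat.pred 2) by (simpl; ring).
      now apply is_derive_pow.
  - intros s Hs. destruct (Hbound s Hs) as [H1 H2].
    eapply Rle_trans; [apply Rabs_triang|]. rewrite !Rabs_mult, (Rabs_pos_eq 2) by lra.
    rewrite <- (pow2_abs (R1 s)), <- (pow2_abs (R2 s)). unfold A, c.
    assert (Ha := Rabs_pos (R1 s)). assert (Hb := Rabs_pos (R2 s)).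
    set (p := Rabs (R1 s)) in *. set (q := Rabs (R2 s)) in *.
    apply Rle_trans with (2 * (p + q) * (K * h ^ 2 + M * (p + q))).
    + apply Rle_trans with (2 * p * (K * h ^ 2 + M * (p + q)) + 2 * q * (K * h ^ 2 + M * (p + q)));
        [|right; ring].
      apply Rplus_le_compat; apply Rmult_le_compat_l; lra.
    + assert (H3 := pow2_ge_0 (K * h ^ 2 - p)). assert (H4 := pow2_ge_0 (K * h ^ 2 - q)).
      assert (H5 : 0 <= M * (p - q) ^ 2).
      { apply Rmult_le_pos; [unfold M; lra|apply pow2_ge_0]. }
      nra.
  - unfold T. lra. }
assert (Hi : R1 0 = 0 /\ R2 0 = 0).
{ unfold R1, R2. destruct (V_initial x Hx) as [-> ->].
  rewrite (F_0 x), (F_0 (x + h)) by lra. simpl. split; ring. }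
destruct Hi as [Hi1 Hi2]. rewrite Hi1, Hi2 in Hg.
fold (R1 t) (R2 t). fold T in Hg.
assert (Hc : 0 <= c / A).
{ apply Rmult_le_pos; [|left; now apply Rinv_0_lt_compat]. unfold c.
  replace (2 * K ^ 2 * h ^ 4) with (2 * (K * h ^ 2) ^ 2) by ring.
  generalize (pow2_ge_0 (K * h ^ 2)). lra. }
replace (2 * K ^ 2 / A * exp (A * T) * h ^ 4) with (c / A * exp (A * T))
  by (unfold c; field; lra).
simpl in Hg. lra.
Qed.

Lemma flow_dx x t : 0 < x < b ->
  is_derive (fun z => fst (F z t)) x (V1 (x, t)) /\
  is_derive (fun z => snd (F z t)) x (V2 (x, t)).
Proof.
intros Hx. destruct (flow_first_order x t Hx) as (r & C & Hr & H).
split; apply is_derive_quadratic with (C := C) (r := r); auto; intros h Hh;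
  specialize (H h Hh); eapply Rle_trans; try exact H.
- generalize (pow2_ge_0 (snd (F (x + h) t) - snd (F x t) - h * V2 (x, t))). lra.
- generalize (pow2_ge_0 (fst (F (x + h) t) - fst (F x t) - h * V1 (x, t))). lra.
Qed.

Lemma flow_class_S n : (n <= 2)%nat -> Cn_plane n E (pull fst) -> Cn_plane n E (pull snd) ->
  Cn_plane (S n) E (pull fst) /\ Cn_plane (S n) E (pull snd).
Proof.
intros Hn H1 H2. destruct (Cn_V n Hn H1 H2) as [HV1 HV2].
destruct (Cn_v n Hn) as [Hv1 Hv2]. split.
- apply (Cn_plane_S_intro E (vstrip_open 0 b) n _ V1 (pull v1)).
  + intros p. now apply Cn_plane_continuous with (n := n).
  + intros x y Hx. now apply flow_dx.
  + intros x y Hx. now apply F_1.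
  + exact HV1.
  + now apply Cn_plane_pull.
- apply (Cn_plane_S_intro E (vstrip_open 0 b) n _ V2 (pull v2)).
  + intros p. now apply Cn_plane_continuous with (n := n).
  + intros x y Hx. now apply flow_dx.
  + intros x y Hx. now apply F_2.
  + exact HV2.
  + now apply Cn_plane_pull.
Qed.

Lemma flow_C2 : Cn_plane 2 E (pull fst) /\ Cn_plane 2 E (pull snd).
Proof.
destruct flow_C0 as [H1 H2].
destruct (flow_class_S 0 ltac:(auto) H1 H2) as [H3 H4].
now apply flow_class_S; auto.
Qed.

Lemma S1_flow x t : 0 < x < b -> S1 F x t = (V1 (x, t), V2 (x, t)).
Proof.
intros Hx. destruct (flow_dx x t Hx) as [H1 H2].
exact (f_equal2 pair (is_derive_unique _ _ _ H1) (is_derive_unique _ _ _ H2)).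
Qed.

(** The exchange of the derivatives of [F] in t and x0, read off from the explicit solution once
    [S1] is known to be (V1, V2). *)
Lemma flow_variational_equation x t : 0 < x < b ->
  is_derive (fun s => fst (S1 F x s)) t
    (dx v1 (F x t) * fst (S1 F x t) + dy v1 (F x t) * snd (S1 F x t)) /\
  is_derive (fun s => snd (S1 F x s)) t
    (dx v2 (F x t) * fst (S1 F x t) + dy v2 (F x t) * snd (S1 F x t)).
Proof.
intros Hx. destruct (V_derive x t Hx) as [H1 H2].
split; eapply is_derive_ext; try (intros s; now rewrite S1_flow);
  rewrite (S1_flow x t Hx); [exact H1|exact H2].
Qed.

Lemma flow_immersion x t : 0 < x < b ->
  v1 (F x t) * snd (S1 F x t) - v2 (F x t) * fst (S1 F x t) <> 0.
Proof.
intros Hx. rewrite (S1_flow x t Hx). unfold V1, V2, pull. simpl.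
(* The component along v drops out: det(v, mu v + nu n) = nu |v|^2. *)
replace (_ - _) with (nu (x, t) * (v1 (F x t) ^ 2 + v2 (F x t) ^ 2)) by ring.
rewrite v_unit by now apply flow_W. rewrite Rmult_1_r. now apply nu_neq0.
Qed.

End Flow.

(** * Partial derivatives in the coordinates of the flow *)

Lemma is_pd_unique i f x t l : is_pd i f x t l -> pd i f x t = l.
Proof. destruct i; apply is_derive_unique. Qed.

Lemma is_pd_const i c x t : is_pd i (fun _ _ => c) x t 0.
Proof.
destruct i.
- exact (is_derive_const (V := R_NormedModule) c t).
- exact (is_derive_const (V := R_NormedModule) c x).
Qed.

Lemma is_pd_plus i f g x t lf lg : is_pd i f x t lf -> is_pd i g x t lg ->
  is_pd i (fun x t => f x t + g x t) x t (lf + lg).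
Proof.
destruct i; intros Hf Hg.
- exact (is_derive_plus (V := R_NormedModule) (f x) (g x) t lf lg Hf Hg).
- exact (is_derive_plus (V := R_NormedModule) (fun z => f z t) (fun z => g z t) x lf lg Hf Hg).
Qed.

Lemma is_pd_opp i f x t lf : is_pd i f x t lf -> is_pd i (fun x t => - f x t) x t (- lf).
Proof.
destruct i; intros Hf.
- exact (is_derive_opp (V := R_NormedModule) (f x) t lf Hf).
- exact (is_derive_opp (V := R_NormedModule) (fun z => f z t) x lf Hf).
Qed.

Lemma is_pd_mult i f g x t lf lg : is_pd i f x t lf -> is_pd i g x t lg ->
  is_pd i (fun x t => f x t * g x t) x t (lf * g x t + f x t * lg).
Proof.
destruct i; intros Hf Hg.
- exact (is_derive_mult (f x) (g x) t lf lg Hf Hg Rmult_comm).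
- exact (is_derive_mult (fun z => f z t) (fun z => g z t) x lf lg Hf Hg Rmult_comm).
Qed.

Lemma is_pd_exp i f x t lf : is_pd i f x t lf ->
  is_pd i (fun x t => exp (f x t)) x t (lf * exp (f x t)).
Proof.
destruct i; intros Hf.
- exact (is_derive_comp exp (f x) t _ lf (is_derive_exp _) Hf).
- exact (is_derive_comp exp (fun z => f z t) x _ lf (is_derive_exp _) Hf).
Qed.

Lemma is_pd_fst (f : R -> R) i x t l : is_derive f x l ->
  is_pd i (fun x _ => f x) x t match i with It => 0 | Ix => l end.
Proof.
destruct i; intros Hf; [|exact Hf].
exact (is_derive_const (V := R_NormedModule) (f x) t).
Qed.

Definition is_pdv (i : idx) (A : R -> R -> vec) (x t : R) (l : vec) : Prop :=
  is_pd i (fun x t => fst (A x t)) x t (fst l) /\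
  is_pd i (fun x t => snd (A x t)) x t (snd l).

Lemma is_pdv_unique i A x t l : is_pdv i A x t l -> pd_vec i A x t = l.
Proof.
intros [H1 H2]. unfold pd_vec.
rewrite (is_pd_unique _ _ _ _ _ H1), (is_pd_unique _ _ _ _ _ H2).
now rewrite <- surjective_pairing.
Qed.

Lemma is_pd_inner i A C x t a c : is_pdv i A x t a -> is_pdv i C x t c ->
  is_pd i (fun x t => inner (A x t) (C x t)) x t (inner a (C x t) + inner (A x t) c).
Proof.
intros [HA1 HA2] [HC1 HC2].
assert (H := is_pd_plus _ _ _ _ _ _ _ (is_pd_mult _ _ _ _ _ _ _ HA1 HC1)
  (is_pd_mult _ _ _ _ _ _ _ HA2 HC2)).
unfold inner.
match type of H with is_pd _ _ _ _ ?l => replace (_ + _) with l by ring end.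
exact H.
Qed.

Lemma is_pd_comp (D : vec -> Prop) f i A x t a : open D -> Cn_plane 1 D f -> D (A x t) ->
  is_pdv i A x t a -> is_pd i (fun x t => f (A x t)) x t (Dscal f (A x t) a).
Proof.
intros HD Hf HA [H1 H2]. unfold Dscal, inner, grad. simpl.
assert (Hs : forall c : R -> vec, forall s la lb, D (c s) ->
  is_derive (fun s => fst (c s)) s la -> is_derive (fun s => snd (c s)) s lb ->
  is_derive (fun s => f (c s)) s (dx f (c s) * la + dy f (c s) * lb)).
{ intros c s la lb Hc Hla Hlb.
  apply (is_derive_ext (fun s => f (fst (c s), snd (c s)))).
  { intros r. now rewrite <- surjective_pairing. }
  assert (H := Cn_plane_chain D HD f (fun s => fst (c s)) (fun s => snd (c s)) s la lb Hf).
  cbv beta in H. rewrite <- surjective_pairing in H. now apply H. }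
destruct i.
- now apply (Hs (A x)).
- now apply (Hs (fun z => A z t)).
Qed.

Lemma is_pd_ext a b i f g x t l : (forall x t, a < x < b -> f x t = g x t) -> a < x < b ->
  is_pd i f x t l -> is_pd i g x t l.
Proof.
intros Hfg Hx. destruct i; simpl.
- apply is_derive_ext. intros s. now apply Hfg.
- apply is_derive_ext_loc.
  generalize (locally_2d_1d_const_y _ _ _
    (open_locally_2d _ x t (vstrip_open a b) Hx)).
  apply filter_imp. intros z Hz. now apply Hfg.
Qed.

(* The chain rule for the Laplacian: [f] plays the role of the frame [dF] and [q] that of the
   second derivatives of [F], so that [dg k i j] stands for the derivative of the metric. *)
Lemma laplace_beltrami_identity (f : idx -> vec) (q : idx -> idx -> vec)
  (K : R) (dK du : vec) (uxx uxy uyx uyy : R) :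
  q It Ix = q Ix It -> fst (f It) * snd (f Ix) - snd (f It) * fst (f Ix) <> 0 ->
  let gi := inv2 (fun i j => inner (f i) (f j)) in
  let dg := fun k i j => inner (q k i) (f j) + inner (f i) (q k j) in
  let Gam := fun i j m => / 2 * isum (fun l => gi m l * (dg i l j + dg j i l - dg l i j)) in
  let hess := fun v w => (uxx * fst v + uxy * snd v) * fst w +
                         (uyx * fst v + uyy * snd v) * snd w in
  inner dK du + K * (uxx + uyy) =
    isum (fun i => isum (fun j => gi i j * K * (hess (f i) (f j) + inner du (q i j)))) +
    isum (fun m => (- K * isum (fun p => isum (fun r => gi p r * Gam p r m)) +
       isum (fun p => gi p m * inner dK (f p))) * inner du (f m)).
Proof.
intros Hq Hdet. cbv zeta.
destruct (q It It) as [a1 a2] eqn:E1. destruct (q It Ix) as [b1 b2] eqn:E2.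
destruct (q Ix Ix) as [c1 c2] eqn:E3.
unfold isum, inv2, det2, inner. rewrite <- Hq, E1, E2, E3.
destruct (f It) as [p1 p2]. destruct (f Ix) as [r1 r2].
destruct dK as [k1 k2]. destruct du as [d1 d2]. simpl in *.
(* Lagrange's identity: the Gram determinant, denominator of the inverse metric, is the square of
   the determinant of the frame. *)
assert (Hd : (p1 * p1 + p2 * p2) * (r1 * r1 + r2 * r2) -
  (p1 * r1 + p2 * r2) * (r1 * p1 + r2 * p2) <> 0).
{ replace (_ - _) with ((p1 * r2 - p2 * r1) ^ 2) by ring. now apply pow_nonzero. }
field. exact Hd.
Qed.

(** * The pullback metric and its Christoffel symbols *)

Section Pullback.

Variables (a : R) (W : vec -> Prop) (v : vec -> vec) (F : R -> R -> vec).

Let E := vstrip 0 a.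

Hypotheses (W_open : open W)
  (v1_C1 : Cn_plane 1 W (fun p => fst (v p))) (v2_C1 : Cn_plane 1 W (fun p => snd (v p)))
  (v_unit : forall p, W p -> inner (v p) (v p) = 1)
  (v_orth : forall p w, W p -> inner (v p) (Dvec v p w) = 0)
  (F_W : forall x t, 0 < x < a -> W (F x t))
  (F1_C2 : Cn_plane 2 E (fun p => fst (F (fst p) (snd p))))
  (F2_C2 : Cn_plane 2 E (fun p => snd (F (fst p) (snd p))))
  (F_t : forall x t, 0 < x < a -> is_pdv It F x t (v (F x t)))
  (S1_t : forall x t, 0 < x < a -> is_pdv It (S1 F) x t (Dvec v (F x t) (S1 F x t)))
  (F_immersion : forall x t, 0 < x < a ->
     fst (v (F x t)) * snd (S1 F x t) - snd (v (F x t)) * fst (S1 F x t) <> 0).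

Lemma S1_C1 : Cn_plane 1 E (fun p => fst (S1 F (fst p) (snd p))) /\
  Cn_plane 1 E (fun p => snd (S1 F (fst p) (snd p))).
Proof. split; [exact (Cn_plane_dx _ _ _ F1_C2)|exact (Cn_plane_dx _ _ _ F2_C2)]. Qed.

Lemma S2_C0 : Cn_plane 0 E (fun p => fst (S2 F (fst p) (snd p))) /\
  Cn_plane 0 E (fun p => snd (S2 F (fst p) (snd p))).
Proof.
split; [exact (Cn_plane_dx _ _ _ (proj1 S1_C1))|exact (Cn_plane_dx _ _ _ (proj2 S1_C1))].
Qed.

Lemma F_x x t : 0 < x < a -> is_pdv Ix F x t (S1 F x t).
Proof.
intros Hx. split.
- exact (Cn_plane_is_dx E 1 _ x t F1_C2 Hx).
- exact (Cn_plane_is_dx E 1 _ x t F2_C2 Hx).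
Qed.

Lemma S1_x x t : 0 < x < a -> is_pdv Ix (S1 F) x t (S2 F x t).
Proof.
intros Hx. split.
- exact (Cn_plane_is_dx E 0 _ x t (proj1 S1_C1) Hx).
- exact (Cn_plane_is_dx E 0 _ x t (proj2 S1_C1) Hx).
Qed.

Definition frame (i : idx) (x t : R) : vec :=
  match i with It => v (F x t) | Ix => S1 F x t end.

(** The k-derivative of [frame i]. Both mixed cases share one value: the chain rule gives Dv[S1] for
    the x0-derivative of v along [F], and the variational equation gives it for the t-derivative of
    [S1]. *)
Definition frame_pd (k i : idx) (x t : R) : vec :=
  match k, i with
  | It, It => Dvec v (F x t) (v (F x t))
  | Ix, Ix => S2 F x t
  | _, _ => Dvec v (F x t) (S1 F x t)
  end.

Lemma is_pdv_F i x t : 0 < x < a -> is_pdv i F x t (frame i x t).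
Proof. destruct i; [apply F_t|apply F_x]. Qed.

Lemma is_pdv_frame k i x t : 0 < x < a -> is_pdv k (frame i) x t (frame_pd k i x t).
Proof.
intros Hx. destruct i; [|destruct k; [now apply S1_t|now apply S1_x]].
assert (H : is_pdv k (fun x t => v (F x t)) x t (Dvec v (F x t) (frame k x t))).
{ split.
  - apply (is_pd_comp W (fun p => fst (v p))); auto. now apply is_pdv_F.
  - apply (is_pd_comp W (fun p => snd (v p))); auto. now apply is_pdv_F. }
destruct k; exact H.
Qed.

Lemma metric_frame i j x t : 0 < x < a ->
  metric F i j x t = inner (frame i x t) (frame j x t).
Proof.
intros Hx. unfold metric.
now rewrite 2!(is_pdv_unique _ _ _ _ _ (is_pdv_F _ x t Hx)).
Qed.

Lemma is_pd_metric k i j x t : 0 < x < a -> is_pd k (metric F i j) x t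
  (inner (frame_pd k i x t) (frame j x t) + inner (frame i x t) (frame_pd k j x t)).
Proof.
intros Hx. apply (is_pd_ext 0 a k (fun x t => inner (frame i x t) (frame j x t))); auto.
- intros z s Hz. symmetry. now apply metric_frame.
- apply is_pd_inner; now apply is_pdv_frame.
Qed.

Lemma inner_comm w z : inner w z = inner z w.
Proof. unfold inner. ring. Qed.

Lemma is_pd_metric_tt k x t : 0 < x < a -> is_pd k (metric F It It) x t 0.
Proof.
intros Hx. apply (is_pd_ext 0 a k (fun _ _ => 1)); auto.
- intros z s Hz. rewrite metric_frame by easy. symmetry. now apply v_unit, F_W.
- apply is_pd_const.
Qed.

Lemma is_pd_t_metric_tx x t : 0 < x < a -> is_pd It (metric F It Ix) x t
  (inner (Dvec v (F x t) (v (F x t))) (S1 F x t)).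
Proof.
intros Hx. evar_last; [now apply is_pd_metric|]. simpl.
(* The product rule leaves the extra term <v, Dv[S1]>, which vanishes because |v| = 1. *)
rewrite v_orth by now apply F_W. ring.
Qed.

Lemma is_pd_x_metric_tx x t : 0 < x < a -> is_pd Ix (metric F It Ix) x t
  (inner (v (F x t)) (S2 F x t) + inner (Dvec v (F x t) (S1 F x t)) (S1 F x t)).
Proof.
intros Hx. rewrite Rplus_comm. exact (is_pd_metric Ix It Ix x t Hx).
Qed.

Lemma is_pd_metric_xx k x t : 0 < x < a -> is_pd k (metric F Ix Ix) x t
  (2 * inner (frame_pd k Ix x t) (S1 F x t)).
Proof.
intros Hx. evar_last; [now apply is_pd_metric|]. simpl.
rewrite (inner_comm (S1 F x t)). ring.
Qed.

Lemma inv_metric_frame i j x t : 0 < x < a ->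
  inv_metric (metric F) i j x t = inv2 (fun p q => inner (frame p x t) (frame q x t)) i j.
Proof.
intros Hx. unfold inv_metric, inv2, det2. destruct i, j; now rewrite !metric_frame.
Qed.

Lemma Christoffel_frame i j m x t : 0 < x < a ->
  let dg := fun k i j => inner (frame_pd k i x t) (frame j x t) +
                         inner (frame i x t) (frame_pd k j x t) in
  Christoffel (metric F) i j m x t =
  / 2 * isum (fun l => inv2 (fun p q => inner (frame p x t) (frame q x t)) m l *
    (dg i l j + dg j i l - dg l i j)).
Proof.
intros Hx. cbv zeta. unfold Christoffel, isum.
now rewrite !(is_pd_unique _ _ _ _ _ (is_pd_metric _ _ _ x t Hx)), !inv_metric_frame.
Qed.

(** The metric and its inverse are symmetric, so exchanging p and q turns the first term of the
    Christoffel symbol into the second under the sum; the factor 1/2 disappears from these two and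
    stays on the third. *)
Lemma contracted_Christoffel m x t : 0 < x < a ->
  isum (fun p => isum (fun q =>
    inv_metric (metric F) p q x t * Christoffel (metric F) p q m x t)) =
  isum (fun i => isum (fun j => isum (fun l =>
    inv_metric (metric F) i j x t * inv_metric (metric F) m l x t *
    pd i (metric F l j) x t))) -
  / 2 * isum (fun i => isum (fun j => isum (fun l =>
    inv_metric (metric F) i j x t * inv_metric (metric F) m l x t *
    pd l (metric F i j) x t))).
Proof.
intros Hx. unfold Christoffel, isum.
assert (Hs : inv_metric (metric F) Ix It x t = inv_metric (metric F) It Ix x t).
{ rewrite 2!inv_metric_frame by easy. unfold inv2.
  now rewrite (inner_comm (frame Ix x t) (frame It x t)). }
rewrite !(is_pd_unique _ _ _ _ _ (is_pd_metric _ _ _ x t Hx)), Hs.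
rewrite !(inner_comm (frame Ix x t)), !(inner_comm (frame It x t)). field.
Qed.

(** * The operator div(K grad u) in the coordinates of the flow *)

Section Laplacian.

Variables (D : vec -> Prop) (u K : vec -> R).
Hypotheses (D_open : open D) (F_D : forall x t, 0 < x < a -> D (F x t))
  (u_C2 : Cn_plane 2 D u) (K_C1 : Cn_plane 1 D K).

Lemma div_scale_grad p : D p ->
  div (fun q => vscale (K q) (grad u q)) p =
  inner (grad K p) (grad u p) + K p * (dx (dx u) p + dy (dy u) p).
Proof.
destruct p as [x y]. intros Hp.
assert (H1 : is_derive (fun z => K (z, y) * dx u (z, y)) x
  (dx K (x, y) * dx u (x, y) + K (x, y) * dx (dx u) (x, y))).
{ apply (is_derive_mult (fun z => K (z, y)) (fun z => dx u (z, y)));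
    [eapply Cn_plane_is_dx; eauto|eapply Cn_plane_is_dx; eauto using Cn_plane_dx|].
  exact Rmult_comm. }
assert (H2 : is_derive (fun z => K (x, z) * dy u (x, z)) y
  (dy K (x, y) * dy u (x, y) + K (x, y) * dy (dy u) (x, y))).
{ apply (is_derive_mult (fun z => K (x, z)) (fun z => dy u (x, z)));
    [eapply Cn_plane_is_dy; eauto|eapply Cn_plane_is_dy; eauto using Cn_plane_dy|].
  exact Rmult_comm. }
unfold div.
replace (dx _ _) with (dx K (x, y) * dx u (x, y) + K (x, y) * dx (dx u) (x, y))
  by (symmetry; exact (is_derive_unique _ _ _ H1)).
replace (dy (fun q => snd (vscale (K q) (grad u q))) (x, y))
  with (dy K (x, y) * dy u (x, y) + K (x, y) * dy (dy u) (x, y))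
  by (symmetry; exact (is_derive_unique _ _ _ H2)).
unfold inner, grad. simpl. ring.
Qed.

Lemma pd_pull f i x t : Cn_plane 1 D f -> 0 < x < a ->
  pd i (fun x t => f (F x t)) x t = inner (grad f (F x t)) (frame i x t).
Proof.
intros Hf Hx. apply is_pd_unique, (is_pd_comp D); auto. now apply is_pdv_F.
Qed.

Lemma pd2_pull i j x t : 0 < x < a ->
  pd i (pd j (fun x t => u (F x t))) x t =
  Dscal (dx u) (F x t) (frame i x t) * fst (frame j x t) +
  Dscal (dy u) (F x t) (frame i x t) * snd (frame j x t) +
  inner (grad u (F x t)) (frame_pd i j x t).
Proof.
intros Hx. apply is_pd_unique.
apply (is_pd_ext 0 a i (fun x t => inner (grad u (F x t)) (frame j x t))); auto.
- intros z s Hz. symmetry. apply pd_pull; auto. now apply (Cn_plane_le _ 2); auto.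
- apply (is_pd_inner i (fun x t => grad u (F x t)) (frame j) x t
    (Dscal (dx u) (F x t) (frame i x t), Dscal (dy u) (F x t) (frame i x t)));
    [|now apply is_pdv_frame].
  split; apply (is_pd_comp D); auto using Cn_plane_dx, Cn_plane_dy; now apply is_pdv_F.
Qed.

Lemma div_scale_grad_pull x t : 0 < x < a ->
  let uF := fun x t => u (F x t) in
  let KF := fun x t => K (F x t) in
  let g := metric F in
  let gi := inv_metric g in
  div (fun q => vscale (K q) (grad u q)) (F x t) =
    isum (fun i => isum (fun j => gi i j x t * KF x t * pd i (pd j uF) x t)) +
    isum (fun m =>
      (- KF x t * isum (fun p => isum (fun q => gi p q x t * Christoffel g p q m x t)) +
       isum (fun p => gi p m x t * pd p KF x t)) * pd m uF x t).
Proof.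
intros Hx. cbv zeta. rewrite div_scale_grad by now apply F_D.
(* [eq_refl] is the symmetry of the second derivatives of [F], built into [frame_pd]. In the
   identity, the sum of g^ij f_i f_j^T is the unit matrix, so the Hessian of [u] contracts to its
   trace. *)
etransitivity; [apply (laplace_beltrami_identity (fun i => frame i x t)
  (fun k i => frame_pd k i x t) (K (F x t)) (grad K (F x t)) (grad u (F x t))
  (dx (dx u) (F x t)) (dy (dx u) (F x t)) (dx (dy u) (F x t)) (dy (dy u) (F x t)) eq_refl);
  now apply F_immersion|].
assert (u_C1 : Cn_plane 1 D u) by now apply (Cn_plane_le _ 2); auto.
unfold isum. rewrite !pd2_pull, !(pd_pull u), !(pd_pull K), !Christoffel_frame,
  !inv_metric_frame by easy.
reflexivity.
Qed.

End Laplacian.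

(** The last vector of [D2scal] is frozen, so only the partials of [f] are differentiated. When [S1]
    is put in its place, the variation of [S1] itself is thus left to the separate term in [S2]. *)
Lemma D2scal_eq f p w z : Cn_plane 2 W f -> W p ->
  D2scal f p w z = Dscal (dx f) p w * fst z + Dscal (dy f) p w * snd z.
Proof.
destruct p as [x y]. intros Hf Hp.
assert (Hl : forall g h : R -> R, forall t lg lh, is_derive g t lg -> is_derive h t lh ->
  Derive (fun s => g s * fst z + h s * snd z) t = lg * fst z + lh * snd z).
{ intros g h t lg lh Hg Hh. apply is_derive_unique.
  exact (is_derive_plus (V := R_NormedModule) _ _ t _ _
    (is_derive_scal_l (V := R_NormedModule) g t lg (fst z) Hg)
    (is_derive_scal_l (V := R_NormedModule) h t lh (snd z) Hh)). }
assert (Hx := Cn_plane_dx _ _ _ Hf). assert (Hy := Cn_plane_dy _ _ _ Hf).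
unfold D2scal. unfold Dscal at 1. unfold inner, grad. simpl.
replace (dx (fun q => Dscal f q z) (x, y))
  with (dx (dx f) (x, y) * fst z + dx (dy f) (x, y) * snd z).
2:{ symmetry. exact (Hl (fun t => dx f (t, y)) (fun t => dy f (t, y)) x _ _
      (Cn_plane_is_dx _ _ _ _ _ Hx Hp) (Cn_plane_is_dx _ _ _ _ _ Hy Hp)). }
replace (dy (fun q => Dscal f q z) (x, y))
  with (dy (dx f) (x, y) * fst z + dy (dy f) (x, y) * snd z).
2:{ symmetry. exact (Hl (fun t => dx f (x, t)) (fun t => dy f (x, t)) y _ _
      (Cn_plane_is_dy _ _ _ _ _ Hx Hp) (Cn_plane_is_dy _ _ _ _ _ Hy Hp)). }
unfold Dscal, inner, grad. simpl. ring.
Qed.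

Lemma is_pd_t_prim f x t : Cn_plane 0 E f -> 0 < x < a ->
  is_pd It (fun x t => prim f (x, t)) x t (f (x, t)).
Proof. exact (is_dy_prim 0 a f x t). Qed.

Lemma is_pd_x_prim f g x t : Cn_plane 1 E f -> 0 < x < a ->
  (forall s, is_pd Ix (fun x s => f (x, s)) x s (g (x, s))) ->
  is_pd Ix (fun x t => prim f (x, t)) x t (prim g (x, t)).
Proof.
intros Hf Hx Hg.
replace (prim g (x, t)) with (prim (dx f) (x, t)); [now apply (is_dx_prim 0 a)|].
apply RInt_ext. intros s _. exact (is_pd_unique _ _ _ _ _ (Hg s)).
Qed.

(** * Derivatives of P + Q times the integral of Psi *)

Section Transport.

Variables (H : vec -> R) (P Q : R -> R) (w : R -> R -> R).
Hypotheses (H_C2 : Cn_plane 2 W H)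
  (P_C2 : Cn_line 2 (fun x => 0 < x < a) P) (Q_C2 : Cn_line 2 (fun x => 0 < x < a) Q)
  (w_eq : forall x t, 0 < x < a ->
     w x t = P x + Q x * RInt (fun s => Psi H F x s) 0 t).

Let HF (p : vec) : R := H (F (fst p) (snd p)).
Let psi (p : vec) : R := exp (- prim HF p).
Let theta (p : vec) : R := - prim (dx HF) p.
Let theta_psi (p : vec) : R := theta p * psi p.
Let D2 (p : vec) : R :=
  D2scal H (F (fst p) (snd p)) (S1 F (fst p) (snd p)) (S1 F (fst p) (snd p)).
Let D1 (p : vec) : R := Dscal H (F (fst p) (snd p)) (S2 F (fst p) (snd p)).

(** The x0-derivative of [theta_psi] by the product rule, with that of [psi] equal to
    [theta_psi]. *)
Let theta_psi_x (p : vec) : R :=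
  - prim (fun q => D2 q + D1 q) p * psi p + theta p * theta_psi p.

Lemma Cn_plane_F n f : (n <= 2)%nat -> Cn_plane n W f ->
  Cn_plane n E (fun p => f (F (fst p) (snd p))).
Proof.
intros Hn Hf.
apply (Cn_plane_comp_vec n W E f (fun p => F (fst p) (snd p))).
- exact W_open.
- apply vstrip_open.
- intros p Hp. now apply F_W.
- exact Hf.
- now apply (Cn_plane_le _ 2).
- now apply (Cn_plane_le _ 2).
Qed.

Lemma HF_C2 : Cn_plane 2 E HF.
Proof. now apply Cn_plane_F. Qed.

Lemma psi_C2 : Cn_plane 2 E psi.
Proof.
apply Cn_plane_exp, Cn_plane_opp, Cn_plane_prim, HF_C2; apply vstrip_open.
Qed.

Lemma theta_C1 : Cn_plane 1 E theta.
Proof.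
apply Cn_plane_opp, Cn_plane_prim, Cn_plane_dx, HF_C2. apply vstrip_open.
Qed.

Lemma theta_psi_C1 : Cn_plane 1 E theta_psi.
Proof.
apply Cn_plane_mult; [apply vstrip_open|apply theta_C1|].
now apply (Cn_plane_le _ 2), psi_C2; auto.
Qed.

Lemma dx_HF x t : 0 < x < a -> dx HF (x, t) = Dscal H (F x t) (S1 F x t).
Proof.
intros Hx. refine (is_pd_unique Ix (fun x t => H (F x t)) x t _ _).
apply (is_pd_comp W); auto; [now apply (Cn_plane_le _ 2); auto|now apply F_x].
Qed.

Lemma dxx_HF x t : 0 < x < a -> dx (dx HF) (x, t) = D2 (x, t) + D1 (x, t).
Proof.
intros Hx. refine (is_pd_unique Ix (fun x t => dx HF (x, t)) x t _ _).
apply (is_pd_ext 0 a Ix (fun x t => inner (grad H (F x t)) (S1 F x t))); auto.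
- intros z s Hz. symmetry. now apply dx_HF.
- unfold D2, D1. simpl. rewrite D2scal_eq by auto.
  apply (is_pd_inner Ix (fun x t => grad H (F x t)) (S1 F) x t
    (Dscal (dx H) (F x t) (S1 F x t), Dscal (dy H) (F x t) (S1 F x t)));
    [|now apply S1_x].
  split; [apply (is_pd_comp W (dx H))|apply (is_pd_comp W (dy H))];
    auto using Cn_plane_dx, Cn_plane_dy; now apply F_x.
Qed.

Lemma Cn_plane_Dscal f (A : vec -> vec) : Cn_plane 1 W f ->
  Cn_plane 0 E (fun p => fst (A p)) -> Cn_plane 0 E (fun p => snd (A p)) ->
  Cn_plane 0 E (fun p => Dscal f (F (fst p) (snd p)) (A p)).
Proof.
intros Hf H1 H2.
apply Cn_plane_plus; try apply vstrip_open; apply Cn_plane_mult; try apply vstrip_open; auto.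
- apply (Cn_plane_F 0 (dx f)); auto. now apply Cn_plane_dx.
- apply (Cn_plane_F 0 (dy f)); auto. now apply Cn_plane_dy.
Qed.

Lemma D2_C0 : Cn_plane 0 E D2.
Proof.
apply (Cn_plane_ext E (vstrip_open 0 a) 0 (fun p =>
  Dscal (dx H) (F (fst p) (snd p)) (S1 F (fst p) (snd p)) * fst (S1 F (fst p) (snd p)) +
  Dscal (dy H) (F (fst p) (snd p)) (S1 F (fst p) (snd p)) * snd (S1 F (fst p) (snd p)))).
{ intros p Hp. symmetry. exact (D2scal_eq H _ _ _ H_C2 (F_W _ _ Hp)). }
destruct S1_C1 as [H1 H2].
assert (H3 := Cn_plane_le _ 1 0 _ ltac:(auto) H1).
assert (H4 := Cn_plane_le _ 1 0 _ ltac:(auto) H2).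
apply Cn_plane_plus; try apply vstrip_open; apply Cn_plane_mult; try apply vstrip_open; auto;
  apply (Cn_plane_Dscal _ (fun p => S1 F (fst p) (snd p))); auto using Cn_plane_dx, Cn_plane_dy.
Qed.

Lemma D1_C0 : Cn_plane 0 E D1.
Proof.
destruct S2_C0 as [H1 H2].
apply (Cn_plane_Dscal _ (fun p => S2 F (fst p) (snd p))); auto.
now apply (Cn_plane_le _ 2); auto.
Qed.

Lemma Theta_eq x t : 0 < x < a -> Theta H F x t = theta (x, t).
Proof.
intros Hx. unfold Theta, theta. f_equal.
apply RInt_ext. intros s _. symmetry. now apply dx_HF.
Qed.

Lemma is_pd_t_psi x t : 0 < x < a ->
  is_pd It (fun x t => psi (x, t)) x t (- HF (x, t) * psi (x, t)).
Proof.
intros Hx. apply (is_pd_exp It (fun x t => - prim HF (x, t))).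
apply (is_pd_opp It (fun x t => prim HF (x, t))), is_pd_t_prim; auto.
now apply (Cn_plane_le _ 2), HF_C2; auto.
Qed.

(** Origin of Theta: it is the x0-derivative of the exponent of Psi, taken under the integral
    sign. *)
Lemma is_pd_x_psi x t : 0 < x < a ->
  is_pd Ix (fun x t => psi (x, t)) x t (theta (x, t) * psi (x, t)).
Proof.
intros Hx. apply (is_pd_exp Ix (fun x t => - prim HF (x, t))).
apply (is_pd_opp Ix (fun x t => prim HF (x, t))), is_pd_x_prim; auto.
- now apply (Cn_plane_le _ 2), HF_C2; auto.
- intros s. exact (Cn_plane_is_dx E 1 HF x s HF_C2 Hx).
Qed.

Lemma is_pd_x_theta x t : 0 < x < a ->
  is_pd Ix (fun x t => theta (x, t)) x t (- prim (fun p => D2 p + D1 p) (x, t)).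
Proof.
intros Hx. apply (is_pd_opp Ix (fun x t => prim (dx HF) (x, t))), is_pd_x_prim; auto.
- apply Cn_plane_dx, HF_C2.
- intros s. rewrite <- dxx_HF by easy.
  exact (Cn_plane_is_dx E 0 (dx HF) x s (Cn_plane_dx _ _ _ HF_C2) Hx).
Qed.

Lemma Cn_line_is_derive f x : Cn_line 2 (fun x => 0 < x < a) f -> 0 < x < a ->
  is_derive f x (Derive f x).
Proof. intros Hf Hx. apply Derive_correct. exact (proj1 (Hf x 1%nat Hx ltac:(auto))). Qed.

Lemma Cn_line_is_derive2 f x : Cn_line 2 (fun x => 0 < x < a) f -> 0 < x < a ->
  is_derive (Derive f) x (Derive_n f 2 x).
Proof. intros Hf Hx. apply Derive_correct. exact (proj1 (Hf x 2%nat Hx ltac:(auto))). Qed.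

Lemma transport_t x t : 0 < x < a -> is_pd It w x t (Q x * Psi H F x t).
Proof.
intros Hx.
apply (is_pd_ext 0 a It (fun x t => P x + Q x * prim psi (x, t))); auto.
{ intros z s Hz. symmetry. now apply w_eq. }
assert (psi_C0 := Cn_plane_le _ 2 0 _ ltac:(auto) psi_C2).
evar_last.
- apply is_pd_plus; [apply (is_pd_fst P It x t (Derive P x)), Cn_line_is_derive; auto|].
  apply is_pd_mult; [apply (is_pd_fst Q It x t (Derive Q x)), Cn_line_is_derive; auto|].
  now apply is_pd_t_prim.
- change (Psi H F x t) with (psi (x, t)). simpl. ring.
Qed.

Lemma pd_transport_t x t : 0 < x < a -> pd It w x t = Q x * psi (x, t).
Proof. intros Hx. now apply is_pd_unique, transport_t. Qed.

Lemma transport_tt x t : 0 < x < a ->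
  is_pd It (pd It w) x t (- H (F x t) * Q x * Psi H F x t).
Proof.
intros Hx.
apply (is_pd_ext 0 a It (fun x t => Q x * psi (x, t))); auto.
{ intros z s Hz. symmetry. now apply pd_transport_t. }
evar_last.
- apply is_pd_mult; [apply (is_pd_fst Q It x t (Derive Q x)), Cn_line_is_derive; auto|].
  now apply is_pd_t_psi.
- change (Psi H F x t) with (psi (x, t)). unfold HF. simpl. ring.
Qed.

Lemma transport_xt x t : 0 < x < a ->
  is_pd Ix (pd It w) x t (Derive Q x * Psi H F x t + Q x * Theta H F x t * Psi H F x t).
Proof.
intros Hx. rewrite Theta_eq by easy.
apply (is_pd_ext 0 a Ix (fun x t => Q x * psi (x, t))); auto.
{ intros z s Hz. symmetry. now apply pd_transport_t. }
evar_last.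
- apply is_pd_mult; [apply (is_pd_fst Q Ix x t (Derive Q x)), Cn_line_is_derive; auto|].
  now apply is_pd_x_psi.
- change (Psi H F x t) with (psi (x, t)). simpl. ring.
Qed.

Lemma RInt_Theta_Psi x t : 0 < x < a ->
  RInt (fun s => Theta H F x s * Psi H F x s) 0 t = prim theta_psi (x, t).
Proof.
intros Hx. apply RInt_ext. intros s _. unfold theta_psi. now rewrite Theta_eq.
Qed.

Lemma transport_x x t : 0 < x < a ->
  is_pd Ix w x t
    (Derive P x + Derive Q x * RInt (fun s => Psi H F x s) 0 t +
     Q x * RInt (fun s => Theta H F x s * Psi H F x s) 0 t).
Proof.
intros Hx. rewrite RInt_Theta_Psi by easy.
apply (is_pd_ext 0 a Ix (fun x t => P x + Q x * prim psi (x, t))); auto.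
{ intros z s Hz. symmetry. now apply w_eq. }
evar_last.
- apply is_pd_plus; [apply (is_pd_fst P Ix x t (Derive P x)), Cn_line_is_derive; auto|].
  apply is_pd_mult; [apply (is_pd_fst Q Ix x t (Derive Q x)), Cn_line_is_derive; auto|].
  apply (is_pd_x_prim psi theta_psi); auto.
  + now apply (Cn_plane_le _ 2), psi_C2; auto.
  + intros s. now apply is_pd_x_psi.
- change (RInt (fun s => Psi H F x s) 0 t) with (prim psi (x, t)). simpl. ring.
Qed.

Lemma pd_transport_x x t : 0 < x < a -> pd Ix w x t =
  Derive P x + Derive Q x * prim psi (x, t) + Q x * prim theta_psi (x, t).
Proof.
intros Hx. rewrite <- RInt_Theta_Psi by easy. now apply is_pd_unique, transport_x.
Qed.

(** Here the fundamental theorem of calculus removes the integrals, whereas [transport_xt]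
    differentiates Q Psi in x0; the agreement of the two orders is an outcome of the computation. *)
Lemma transport_tx x t : 0 < x < a ->
  is_pd It (pd Ix w) x t (Derive Q x * Psi H F x t + Q x * Theta H F x t * Psi H F x t).
Proof.
intros Hx. rewrite Theta_eq by easy.
apply (is_pd_ext 0 a It (fun x t => Derive P x + Derive Q x * prim psi (x, t) +
  Q x * prim theta_psi (x, t))); auto.
{ intros z s Hz. symmetry. now apply pd_transport_x. }
assert (psi_C0 := Cn_plane_le _ 2 0 _ ltac:(auto) psi_C2).
assert (theta_psi_C0 := Cn_plane_le _ 1 0 _ ltac:(auto) theta_psi_C1).
evar_last.
- apply is_pd_plus; [apply is_pd_plus|].
  + apply (is_pd_fst (Derive P) It x t (Derive_n P 2 x)), Cn_line_is_derive2; auto.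
  + apply is_pd_mult; [apply (is_pd_fst (Derive Q) It x t (Derive_n Q 2 x)), Cn_line_is_derive2; auto|].
    now apply is_pd_t_prim.
  + apply is_pd_mult; [apply (is_pd_fst Q It x t (Derive Q x)), Cn_line_is_derive; auto|].
    exact (is_pd_t_prim theta_psi x t theta_psi_C0 Hx).
- change (Psi H F x t) with (psi (x, t)). unfold theta_psi. simpl. ring.
Qed.

Lemma transport_xx x t : 0 < x < a ->
  is_pd Ix (pd Ix w) x t
    (Derive_n P 2 x + Derive_n Q 2 x * RInt (fun s => Psi H F x s) 0 t +
     2 * Derive Q x * RInt (fun s => Theta H F x s * Psi H F x s) 0 t +
     Q x * RInt (fun s => (Theta H F x s) ^ 2 * Psi H F x s) 0 t -
     Q x * RInt (fun s =>
       RInt (fun tau => D2scal H (F x tau) (S1 F x tau) (S1 F x tau)) 0 s *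
       Psi H F x s) 0 t -
     Q x * RInt (fun s =>
       RInt (fun tau => Dscal H (F x tau) (S2 F x tau)) 0 s *
       Psi H F x s) 0 t).
Proof.
intros Hx. rewrite RInt_Theta_Psi by easy.
replace (RInt (fun s => (Theta H F x s) ^ 2 * Psi H F x s) 0 t)
  with (prim (fun p => theta p ^ 2 * psi p) (x, t))
  by (apply RInt_ext; intros s _; now rewrite Theta_eq).
assert (psi_C0 := Cn_plane_le _ 2 0 _ ltac:(auto) psi_C2).
assert (theta_C0 := Cn_plane_le _ 1 0 _ ltac:(auto) theta_C1).
assert (Hint : forall f, Cn_plane 0 E f ->
  ex_RInt (fun s => prim f (x, s) * psi (x, s)) 0 t).
{ intros f Hf. apply (vstrip_ex_RInt 0 a (fun p => prim f p * psi p)); auto.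
  apply Cn_plane_mult; auto; [apply vstrip_open|now apply Cn_plane_prim]. }
(* Differentiation under the integral sign produces one integral; linearity separates it into the
   three of the statement, once each is known to exist. *)
assert (Hsplit : prim theta_psi_x (x, t) =
  prim (fun p => theta p ^ 2 * psi p) (x, t) - prim (fun p => prim D2 p * psi p) (x, t) -
  prim (fun p => prim D1 p * psi p) (x, t)).
{ assert (Hth : ex_RInt (fun s => theta (x, s) ^ 2 * psi (x, s)) 0 t).
  { apply (vstrip_ex_RInt 0 a (fun p => theta p ^ 2 * psi p)); auto.
    repeat (apply Cn_plane_mult; try apply vstrip_open; auto).
    apply Cn_plane_const, vstrip_open. }
  assert (H2 := Hint D2 D2_C0). assert (H1 := Hint D1 D1_C0).
  assert (E1 := RInt_minus (V := R_CompleteNormedModule) _ _ _ _ Hth H2).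
  assert (E2 := RInt_minus (V := R_CompleteNormedModule) _ _ _ _
    (ex_RInt_minus (V := R_NormedModule) _ _ _ _ Hth H2) H1).
  refine (eq_trans _ (eq_trans E2
    (f_equal (fun z => z - prim (fun p => prim D1 p * psi p) (x, t)) E1))).
  apply RInt_ext. intros s _. unfold theta_psi_x. simpl.
  assert (E3 : prim (fun q => D2 q + D1 q) (x, s) = prim D2 (x, s) + prim D1 (x, s)).
  { apply (RInt_plus (V := R_CompleteNormedModule)); apply (vstrip_ex_RInt 0 a); auto;
      [apply D2_C0|apply D1_C0]. }
  rewrite E3. unfold theta_psi, minus, plus, opp; simpl. ring. }
apply (is_pd_ext 0 a Ix (fun x t => Derive P x + Derive Q x * prim psi (x, t) +
  Q x * prim theta_psi (x, t))); auto.
{ intros z s Hz. symmetry. now apply pd_transport_x. }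
evar_last.
- apply is_pd_plus; [apply is_pd_plus|].
  + apply (is_pd_fst (Derive P) Ix x t (Derive_n P 2 x)), Cn_line_is_derive2; auto.
  + apply is_pd_mult; [apply (is_pd_fst (Derive Q) Ix x t (Derive_n Q 2 x)), Cn_line_is_derive2; auto|].
    apply (is_pd_x_prim psi theta_psi); auto.
    * now apply (Cn_plane_le _ 2), psi_C2; auto.
    * intros s. now apply is_pd_x_psi.
  + apply is_pd_mult; [apply (is_pd_fst Q Ix x t (Derive Q x)), Cn_line_is_derive; auto|].
    apply (is_pd_x_prim theta_psi theta_psi_x); auto.
    * apply theta_psi_C1.
    * intros s. apply (is_pd_mult Ix (fun x s => theta (x, s)) (fun x s => psi (x, s)));
        [now apply is_pd_x_theta|now apply is_pd_x_psi].
(* The coefficient 2 Q' has two sources: the derivative of the integral in Q' int Psi and the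
   derivative of Q in Q int Theta Psi. *)
- rewrite Hsplit.
  change (RInt (fun s => Psi H F x s) 0 t) with (prim psi (x, t)).
  change (RInt (fun s => RInt (fun tau => D2scal H (F x tau) (S1 F x tau) (S1 F x tau)) 0 s *
    Psi H F x s) 0 t) with (prim (fun p => prim D2 p * psi p) (x, t)).
  change (RInt (fun s => RInt (fun tau => Dscal H (F x tau) (S2 F x tau)) 0 s *
    Psi H F x s) 0 t) with (prim (fun p => prim D1 p * psi p) (x, t)).
  cbv beta iota. ring.
Qed.

End Transport.

End Pullback.

(** * The normalized field *)

Lemma Cn_plane_subset n (D E : vec -> Prop) f :
  (forall p, E p -> D p) -> Cn_plane n D f -> Cn_plane n E f.
Proof. intros HED Hf x y Hp. now apply Hf, HED. Qed.

Section Normalized.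

Variables (D : vec -> Prop) (B : vec -> vec).
Hypotheses (D_open : open D) (B_neq0 : forall p, D p -> 0 < inner (B p) (B p)).

Lemma normalize_unit p : D p -> inner (normalize B p) (normalize B p) = 1.
Proof.
intros Hp. assert (H := B_neq0 p Hp).
unfold normalize, vscale, inner at 1. simpl. fold (norm2 (B p)).
replace (_ + _) with (inner (B p) (B p) / (norm2 (B p) * norm2 (B p))).
- unfold norm2. rewrite sqrt_sqrt by lra. field. lra.
- assert (0 < norm2 (B p)) by now apply sqrt_lt_R0.
  unfold inner. field. lra.
Qed.

Lemma Cn_plane_normalize n : Cn_plane_vec n D B -> Cn_plane_vec n D (normalize B).
Proof.
intros [H1 H2].
assert (H : Cn_plane n D (fun p => / norm2 (B p))).
{ apply Cn_plane_inv; auto.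
  - intros p Hp. apply Rgt_not_eq. now apply sqrt_lt_R0, B_neq0.
  - apply Cn_plane_sqrt; auto.
    apply Cn_plane_plus; auto; apply Cn_plane_mult; auto. }
split; apply Cn_plane_mult; auto.
Qed.

(** [Hfun] contains first derivatives of [v] and [k], which costs one class. *)
Lemma Cn_plane_Hfun n k v : Cn_plane (S n) D k -> (forall p, D p -> k p <> 0) ->
  Cn_plane_vec (S n) D v -> Cn_plane n D (Hfun k v).
Proof.
intros Hk Hk0 [H1 H2].
assert (Hle : forall f, Cn_plane (S n) D f -> Cn_plane n D f).
{ intros f. apply Cn_plane_le. auto. }
apply (Cn_plane_ext D D_open n (fun p =>
  (dx (fun q => fst (v q)) p + dy (fun q => snd (v q)) p) +
  (dx k p * fst (v p) + dy k p * snd (v p)) * / k p)).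
- intros p Hp. unfold Hfun, trace, Dvec, Dscal, inner, grad. simpl. field. now apply Hk0.
- apply Cn_plane_plus; auto.
  + apply Cn_plane_plus; auto; [now apply Cn_plane_dx|now apply Cn_plane_dy].
  + apply Cn_plane_mult; auto; [|apply Cn_plane_inv; auto].
    apply Cn_plane_plus; auto; apply Cn_plane_mult; auto;
      [now apply Cn_plane_dx|now apply Cn_plane_dy].
Qed.

End Normalized.

Theorem theorem1 :
  forall (eps d L : R) (B : vec -> vec) (k K : vec -> R) (Phi : R -> vec -> vec)
         (alpha : R) (u : vec -> R) (P Q : R -> R),
  standing eps d L B ->
  Cn_plane_vec 3 plane B ->
  Cn_plane 3 plane k ->
  Cn_plane 1 plane K ->
  (forall p, k p <> 0) ->
  is_flow eps d L (normalize B) Phi ->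
  0 < alpha < d / 2 ->
  let b := normalize B in
  let F := flow_coord L Phi in
  let H := Hfun k b in
  let uF := fun x0 t => u (F x0 t) in
  let KF := fun x0 t => K (F x0 t) in
  let g := metric F in
  let gi := inv_metric g in
  let Gam := Christoffel g in
  Cn_plane 2 (D_alpha d alpha F) u ->
  (forall p, D_alpha d alpha F p ->
     div (fun q => vscale (k q) (tensor (b q) (b q) (grad u q))) p = 0) ->
  Cn_line 2 (fun x => 0 < x < alpha) P ->
  Cn_line 2 (fun x => 0 < x < alpha) Q ->
  (forall x0 t, 0 < x0 < alpha ->
     uF x0 t = P x0 + Q x0 * RInt (fun s => Psi H F x0 s) 0 t) ->
  forall x0 t, 0 < x0 < alpha ->
  div (fun q => vscale (K q) (grad u q)) (F x0 t) =
    isum (fun i => isum (fun j => gi i j x0 t * KF x0 t * pd i (pd j uF) x0 t)) +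
    isum (fun m =>
      (- KF x0 t * isum (fun p => isum (fun q => gi p q x0 t * Gam p q m x0 t)) +
       isum (fun p => gi p m x0 t * pd p KF x0 t)) * pd m uF x0 t) /\
  is_pd It uF x0 t (Q x0 * Psi H F x0 t) /\
  is_pd It (pd It uF) x0 t (- H (F x0 t) * Q x0 * Psi H F x0 t) /\
  is_pd Ix uF x0 t
    (Derive P x0 + Derive Q x0 * RInt (fun s => Psi H F x0 s) 0 t +
     Q x0 * RInt (fun s => Theta H F x0 s * Psi H F x0 s) 0 t) /\
  is_pd It (pd Ix uF) x0 t
    (Derive Q x0 * Psi H F x0 t + Q x0 * Theta H F x0 t * Psi H F x0 t) /\
  is_pd Ix (pd It uF) x0 t
    (Derive Q x0 * Psi H F x0 t + Q x0 * Theta H F x0 t * Psi H F x0 t) /\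
  is_pd Ix (pd Ix uF) x0 t
    (Derive_n P 2 x0 + Derive_n Q 2 x0 * RInt (fun s => Psi H F x0 s) 0 t +
     2 * Derive Q x0 * RInt (fun s => Theta H F x0 s * Psi H F x0 s) 0 t +
     Q x0 * RInt (fun s => (Theta H F x0 s) ^ 2 * Psi H F x0 s) 0 t -
     Q x0 * RInt (fun s =>
       RInt (fun tau => D2scal H (F x0 tau) (S1 F x0 tau) (S1 F x0 tau)) 0 s *
       Psi H F x0 s) 0 t -
     Q x0 * RInt (fun s =>
       RInt (fun tau => Dscal H (F x0 tau) (S2 F x0 tau)) 0 s *
       Psi H F x0 s) 0 t) /\
  (forall m,
     isum (fun p => isum (fun q => gi p q x0 t * Gam p q m x0 t)) =
     isum (fun i => isum (fun j => isum (fun l =>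
       gi i j x0 t * gi m l x0 t * pd i (g l j) x0 t))) -
     / 2 * isum (fun i => isum (fun j => isum (fun l =>
       gi i j x0 t * gi m l x0 t * pd l (g i j) x0 t)))) /\
  is_pd It (g It It) x0 t 0 /\
  is_pd Ix (g It It) x0 t 0 /\
  is_pd It (g It Ix) x0 t
    (inner (Dvec b (F x0 t) (b (F x0 t))) (S1 F x0 t)) /\
  is_pd Ix (g It Ix) x0 t
    (inner (b (F x0 t)) (S2 F x0 t) +
     inner (Dvec b (F x0 t) (S1 F x0 t)) (S1 F x0 t)) /\
  is_pd It (g Ix Ix) x0 t
    (2 * inner (Dvec b (F x0 t) (S1 F x0 t)) (S1 F x0 t)) /\
  is_pd Ix (g Ix Ix) x0 t
    (2 * inner (S2 F x0 t) (S1 F x0 t)).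
Proof.
intros eps d L B k K Phi alpha u P Q Hst HB Hk HK Hk0 Hflow Hal b F H uF KF g gi Gam
  Hu _ HP HQ HuF x0 t Hx.
destruct Hst as [eps_gt0 d_gt0 L_gt0 _ Bx_low Bx_high _ _ By_left' _ Bx_wall _].
(* To the left of the singular point B_y > 0, so the normalization is smooth there and its second
   component is positive. *)
set (W := vstrip (- eps) (d / 2)).
assert (W_open : open W) by apply vstrip_open.
assert (HBW : forall p, W p -> 0 < inner (B p) (B p)).
{ intros [x y] Hp. generalize (By_left' x y Hp). unfold inner. nra. }
assert (Hnorm : forall p, W p -> 0 < / norm2 (B p)).
{ intros p Hp. now apply Rinv_0_lt_compat, sqrt_lt_R0, HBW. }
assert (HBC : Cn_plane_vec 3 W B).
{ destruct HB as [HB1 HB2].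
  split; [apply (Cn_plane_subset 3 plane W)|apply (Cn_plane_subset 3 plane W)];
    unfold plane; auto. }
destruct (Cn_plane_normalize W B W_open HBW 3 HBC) as [b1_C3 b2_C3].
fold b in b1_C3, b2_C3.
assert (b_inner := normalize_unit W B HBW). fold b in b_inner.
assert (b_unit : forall p, W p -> fst (b p) ^ 2 + snd (b p) ^ 2 = 1).
{ intros p Hp. rewrite <- (b_inner p Hp). unfold inner. ring. }
assert (b2_gt0 : forall p, W p -> 0 < snd (b p)).
{ intros [x y] Hp. apply Rmult_lt_0_compat; [now apply Hnorm|now apply By_left']. }
assert (b1_wall : forall y, fst (b (0, y)) = 0).
{ intros y. simpl. rewrite (proj1 (Bx_wall y)). ring. }
assert (b1_low : forall x y, 0 < x < d / 2 -> y < L / 2 -> 0 < fst (b (x, y))).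
{ intros x y Hxd Hy. apply Rmult_lt_0_compat; [|apply Bx_low; lra].
  apply Hnorm. unfold W, vstrip. simpl. lra. }
assert (b1_high : forall x y, 0 < x < d / 2 -> L / 2 < y -> fst (b (x, y)) < 0).
{ intros x y Hxd Hy. simpl. rewrite <- (Rmult_0_r (/ norm2 (B (x, y)))).
  apply Rmult_lt_compat_l; [|apply Bx_high; lra].
  apply Hnorm. unfold W, vstrip. simpl. lra. }
set (b1 := fun p => fst (b p)) in *. set (b2 := fun p => snd (b p)) in *.
assert (F_0 : forall x, 0 < x < d / 2 -> F x 0 = (x, L / 2)).
{ intros x Hxd. exact (proj1 (Hflow x ltac:(lra))). }
assert (F_1 : forall x t, 0 < x < d / 2 -> is_derive (fun s => fst (F x s)) t (fst (b (F x t)))).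
{ intros x s Hxd. exact (proj1 (proj2 (proj2 (Hflow x ltac:(lra)) s))). }
assert (F_2 : forall x t, 0 < x < d / 2 -> is_derive (fun s => snd (F x s)) t (snd (b (F x t)))).
{ intros x s Hxd. exact (proj2 (proj2 (proj2 (Hflow x ltac:(lra)) s))). }
assert (F_W : forall x t, 0 < x < alpha -> W (F x t)).
{ intros x s Hxa. assert (Hxd : 0 < x < d / 2) by lra.
  apply (flow_W eps (d / 2) (L / 2) b1 b2 F); auto. }
assert (F_D : forall x t, 0 < x < alpha -> D_alpha d alpha F (F x t)).
{ intros x s Hxa. destruct Hal as [_ Hal].
  apply (flow_D_alpha eps (d / 2) (L / 2) b1 b2 F); auto. }
assert (D_open : open (D_alpha d alpha F)).
{ apply (D_alpha_open eps (d / 2) (L / 2) b1 b2 F); auto. }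
assert (F_C2 : Cn_plane 2 (vstrip 0 (d / 2)) (pull F fst) /\
  Cn_plane 2 (vstrip 0 (d / 2)) (pull F snd)).
{ apply (flow_C2 eps (d / 2) (L / 2) b1 b2 F); auto. }
(* The flow lemmas cover starting abscissae up to d / 2, so that alpha itself, whose trajectory
   bounds [D_alpha], is among them; the coordinates use (0, alpha) only. *)
assert (Hsub : forall p, vstrip 0 alpha p -> vstrip 0 (d / 2) p) by (unfold vstrip; intros; lra).
assert (F1_C2 := Cn_plane_subset 2 _ _ _ Hsub (proj1 F_C2)).
assert (F2_C2 := Cn_plane_subset 2 _ _ _ Hsub (proj2 F_C2)).
assert (F_t : forall x t, 0 < x < alpha -> is_pdv It F x t (b (F x t))).
{ intros x s Hxa. split; [apply F_1|apply F_2]; lra. }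
assert (S1_t : forall x t, 0 < x < alpha -> is_pdv It (S1 F) x t (Dvec b (F x t) (S1 F x t))).
{ intros x s Hxa. assert (Hxd : 0 < x < d / 2) by lra.
  apply (flow_variational_equation eps (d / 2) (L / 2) b1 b2 F);
    auto. }
assert (F_imm : forall x t, 0 < x < alpha ->
  fst (b (F x t)) * snd (S1 F x t) - snd (b (F x t)) * fst (S1 F x t) <> 0).
{ intros x s Hxa. assert (Hxd : 0 < x < d / 2) by lra.
  apply (flow_immersion eps (d / 2) (L / 2) b1 b2 F); auto. }
(* Db[w] is a linear combination of the two partials of b, each orthogonal to b. *)
assert (b_orth : forall p w, W p -> inner (b p) (Dvec b p w) = 0).
{ intros p w Hp.
  assert (Ux := W_unit_dx eps (d / 2) b1 b2 b1_C3 b2_C3 b_unit p Hp).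
  assert (Uy := W_unit_dy eps (d / 2) b1 b2 b1_C3 b2_C3 b_unit p Hp).
  change (b1 p * (dx b1 p * fst w + dy b1 p * snd w) +
    b2 p * (dx b2 p * fst w + dy b2 p * snd w) = 0).
  replace (_ + _) with ((b1 p * dx b1 p + b2 p * dx b2 p) * fst w +
    (b1 p * dy b1 p + b2 p * dy b2 p) * snd w) by ring.
  rewrite Ux, Uy. ring. }
assert (b1_C1 : Cn_plane 1 W (fun p => fst (b p))) by (apply (Cn_plane_le _ 3); auto).
assert (b2_C1 : Cn_plane 1 W (fun p => snd (b p))) by (apply (Cn_plane_le _ 3); auto).
assert (H_C2 : Cn_plane 2 W H).
{ apply Cn_plane_Hfun; auto; [|now split].
  apply (Cn_plane_subset 3 plane W); unfold plane; auto. }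
assert (K_C1 : Cn_plane 1 (D_alpha d alpha F) K).
{ apply (Cn_plane_subset 1 plane); unfold plane; auto. }
split; [apply (div_scale_grad_pull alpha W b F) with (D := D_alpha d alpha F); assumption|].
split; [apply (transport_t alpha W F) with (P := P) (Q := Q); assumption|].
split; [apply (transport_tt alpha W F) with (P := P) (Q := Q); assumption|].
split; [apply (transport_x alpha W F) with (P := P) (Q := Q); assumption|].
split; [apply (transport_tx alpha W F) with (P := P) (Q := Q); assumption|].
split; [apply (transport_xt alpha W F) with (P := P) (Q := Q); assumption|].
split; [apply (transport_xx alpha W F) with (P := P) (Q := Q); assumption|].
split; [intros m; apply (contracted_Christoffel alpha W b F); assumption|].
split; [apply (is_pd_metric_tt alpha W b F); assumption|].
split; [apply (is_pd_metric_tt alpha W b F); assumption|].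
split; [apply (is_pd_t_metric_tx alpha W b F); assumption|].
split; [apply (is_pd_x_metric_tx alpha W b F); assumption|].
split; [apply (is_pd_metric_xx alpha W b F) with (k := It); assumption|].
apply (is_pd_metric_xx alpha W b F) with (k := Ix); assumption.
Qed.
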